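(* Let $n \geq 4$, and let $E$ be the set of all algebraic curvature operators $R$ on $\mathbb{R}^n$ such that the induced algebraic curvature operator $S$ on $\mathbb{R}^n \times \mathbb{R}^2$, defined by $$S(\hat{v}_1,\hat{v}_2,\hat{v}_3,\hat{v}_4) = R(v_1,v_2,v_3,v_4) + \langle x_1,x_3 \rangle \langle x_2,x_4 \rangle - \langle x_1,x_4 \rangle \langle x_2,x_3 \rangle$$ for $\hat{v}_j = (v_j,x_j) \in \mathbb{R}^n \times \mathbb{R}^2$, has nonnegative isotropic curvature. Suppose that $R(t)$, $t \in [0,T)$, is a solution, in the space of algebraic curvature operators on $\mathbb{R}^n$, of the ODE $\frac{d}{dt} R(t) = Q(R(t))$ with $R(0) \in E$. Then $R(t) \in E$ for all $t \in [0,T)$.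
   Context: An algebraic curvature operator on a finite-dimensional Euclidean space $V$ is a four-linear form $R$ on $V$ satisfying $R(x,y,z,w) = -R(y,x,z,w) = -R(x,y,w,z) = R(z,w,x,y)$ and the first Bianchi identity $R(x,y,z,w) + R(x,z,w,y) + R(x,w,y,z) = 0$. If $\dim V \geq 4$, it has nonnegative isotropic curvature if $$R(e_1,e_3,e_1,e_3) + R(e_1,e_4,e_1,e_4) + R(e_2,e_3,e_2,e_3) + R(e_2,e_4,e_2,e_4) - 2 R(e_1,e_2,e_3,e_4) \geq 0$$ for all orthonormal four-frames $\{e_1,e_2,e_3,e_4\}$ in $V$. The space $\mathbb{R}^n \times \mathbb{R}^2$ carries the standard product inner product. For an algebraic curvature operator $R$ on $\mathbb{R}^n$, with components $R_{ijkl}$ in an orthonormal basis, $Q(R)$ is the algebraic curvature operator $$Q(R)_{ijkl} = \sum_{p,q=1}^n \big( R_{ijpq} R_{klpq} + 2 R_{ipkq} R_{jplq} - 2 R_{iplq} R_{jpkq} \big).$$ *)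

(* Defs.v *)
From HB Require Import structures.
From mathcomp Require Import all_boot all_order all_algebra.
From mathcomp Require Import all_classical all_reals all_analysis.
Set Implicit Arguments.
Unset Strict Implicit.
Unset Printing Implicit Defensive.
Import Order.TTheory GRing.Theory Num.Theory.
Import numFieldNormedType.Exports.
Local Open Scope classical_set_scope.
Local Open Scope ring_scope.

Definition form4 (K : realType) (V : lmodType K) := V -> V -> V -> V -> K.

Definition four_linear (K : realType) (V : lmodType K) (R : form4 V) : Prop :=
  [/\ forall y z w, scalar (fun x => R x y z w),
      forall x z w, scalar (fun y => R x y z w),
      forall x y w, scalar (fun z => R x y z w)
    & forall x y z, scalar (fun w => R x y z w)].

Definition algebraic_curvature_operator (K : realType) (V : lmodType K)
    (R : form4 V) : Prop :=
  [/\ four_linear R,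
      forall x y z w, R x y z w = - R y x z w,
      forall x y z w, R x y z w = - R x y w z,
      forall x y z w, R x y z w = R z w x y
    & forall x y z w, R x y z w + R x z w y + R x w y z = 0].

Definition orthonormal_frame (K : realType) (V : lmodType K)
    (ip : V -> V -> K) (e : seq V) : Prop :=
  forall i j, (i < size e)%N -> (j < size e)%N -> ip e`_i e`_j = (i == j)%:R.

(* [ip] is the inner product of the Euclidean space [V]. *)
Definition nonneg_isotropic_curvature (K : realType) (V : lmodType K)
    (ip : V -> V -> K) (R : form4 V) : Prop :=
  forall e1 e2 e3 e4 : V, orthonormal_frame ip [:: e1; e2; e3; e4] ->
    0 <= R e1 e3 e1 e3 + R e1 e4 e1 e4 + R e2 e3 e2 e3 + R e2 e4 e2 e4
         - 2 * R e1 e2 e3 e4.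

Definition dot (K : realType) (n : nat) (x y : 'rV[K]_n) : K :=
  \sum_(i < n) x 0 i * y 0 i.

Definition prod_dot (K : realType) (n m : nat)
    (x y : 'rV[K]_n * 'rV[K]_m) : K :=
  dot x.1 y.1 + dot x.2 y.2.

Definition basis_vec (K : realType) (n : nat) (i : 'I_n) : 'rV[K]_n :=
  delta_mx 0 i.
Arguments basis_vec {K n} i.

(* The four-linear form whose components on the standard basis are
   Q(R)_{ijkl} = \sum_(p, q) (R_{ijpq} R_{klpq} + 2 R_{ipkq} R_{jplq}
                              - 2 R_{iplq} R_{jpkq}). *)
Definition Q (K : realType) (n : nat) (R : form4 'rV[K]_n) : form4 'rV[K]_n :=
  fun x y z w =>
    let e := @basis_vec K n in
    \sum_(p < n) \sum_(q < n)
      (R x y (e p) (e q) * R z w (e p) (e q)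
       + 2 * R x (e p) z (e q) * R y (e p) w (e q)
       - 2 * R x (e p) w (e q) * R y (e p) z (e q)).

Definition induced_form (K : realType) (n : nat) (R : form4 'rV[K]_n) :
    form4 ('rV[K]_n * 'rV[K]_2)%type :=
  fun v1 v2 v3 v4 =>
    R v1.1 v2.1 v3.1 v4.1
    + dot v1.2 v3.2 * dot v2.2 v4.2 - dot v1.2 v4.2 * dot v2.2 v3.2.

Definition E (K : realType) (n : nat) : set (form4 'rV[K]_n) :=
  [set R | algebraic_curvature_operator R /\
           nonneg_isotropic_curvature (@prod_dot K n 2) (induced_form R)].
Arguments E {K n}.

(* [0, T), where T = +oo is allowed. *)
Definition time_interval (K : realType) (T : \bar K) : set K :=
  [set t | 0 <= t /\ (t%:E < T)%E].

(* Derivative relative to D: two-sided at interior points of D, one-sided at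
   an endpoint of an interval D. *)
Definition has_derivative_within (K : realType) (D : set K) (f : K -> K)
    (t l : K) : Prop :=
  (f s - f t) / (s - t) @[s --> within D t^'] --> l.

(* Solution of dR/dt = Q(R) on [0, T) in the space of algebraic curvature
   operators. Since that space is finite-dimensional, the derivative is
   expressed pointwise on quadruples of vectors. *)
Definition Q_ode_solution (K : realType) (n : nat) (T : \bar K)
    (R : K -> form4 'rV[K]_n) : Prop :=
  forall t, time_interval T t ->
    algebraic_curvature_operator (R t) /\
    forall x y z w, has_derivative_within (time_interval T)
      (fun s => R s x y z w) t (Q (R t) x y z w).

(* Main.v *)
Require Import Defs.
From HB Require Import structures.
From mathcomp Require Import all_boot all_order all_algebra.
From mathcomp Require Import all_classical all_reals all_analysis.
From mathcomp Require Import spectral complex ring lra.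
Set Implicit Arguments.
Unset Strict Implicit.
Unset Printing Implicit Defensive.
Import Order.TTheory GRing.Theory Num.Theory.
Import numFieldNormedType.Exports.
Local Open Scope classical_set_scope.
Local Open Scope ring_scope.

(* Extend R to complex vectors.  Solving for the components in the plane factor
   shows that R lies in E iff R(x, y, x^bar, y^bar) + |(x /\ y, x /\ y)| >= 0
   for all x, y in C^n, where (.,.) is the complex bilinear form on bivectors.
   The second term and the set of decomposable bivectors are invariant under
   SO(n, C), so Wilking's argument applies: at a zero X = x /\ y, the second
   variation along exp(s A) and exp(i s A) gives R([A,X], [A,X]^bar) >= 0 for
   every A in so(n, C).  Up to a factor, Q(R)(X, X^bar) is a sum of squares plus
   the trace of the Hermitian form A |-> R([A,X], [A,X]^bar) against R; on the
   eigenvectors of that form, which again have the form [L,X], R is nonnegative,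
   so Q(R)(X, X^bar) >= 0.  A barrier R + delta I with delta growing
   exponentially turns this null-vector condition into invariance of E. *)

(** * Hermitian extension of a curvature tensor *)

(** The plane factor produces the modulus term for two reasons. Every complex symmetric 2 by 2
    matrix is the Gram matrix of some x', y' in C^2, so any x, y in C^n can be completed to an
    isotropic pair (x, x'), (y, y'). Moreover the bivectors of C^2 form a line, so |x' /\ y'|^2 is
    the modulus of the complex square of x' /\ y', which depends on the Gram matrix alone. The
    obstacle is that this modulus is not smooth where the square vanishes. It is never
    differentiated: the complex orthogonal motions keep it fixed, and it does not involve R, so
    along the flow only the term linear in R varies. SO(n, C) is not compact, but both terms are
    homogeneous of the same degree in x /\ y. One may thus restrict to Hermitian-orthogonal pairs of
    fixed length. These form a compact set, which gives a first contact time, and on it the sphere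
    tensor is constant, so the barrier shifts all values by the same amount. *)

Definition tensor4 (F : Type) (n : nat) := 'I_n -> 'I_n -> 'I_n -> 'I_n -> F.

Definition curvature_symmetries (F : zmodType) n (r : tensor4 F n) :=
  [/\ forall i j k l, r j i k l = - r i j k l,
      forall i j k l, r i j l k = - r i j k l
    & forall i j k l, r k l i j = r i j k l].

Definition Qtensor (F : pzRingType) n (r : tensor4 F n) : tensor4 F n :=
  fun i j k l => \sum_p \sum_q
    (r i j p q * r k l p q + 2 * r i p k q * r j p l q
     - 2 * r i p l q * r j p k q).

Definition cdot (F : pzSemiRingType) n (x y : 'rV[F]_n) : F := (x *m y^T) 0 0.

(* The square of [x /\ y] for the bilinear form induced on bivectors. *)
Definition gram2 (F : pzRingType) n (x y : 'rV[F]_n) : F :=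
  cdot x x * cdot y y - cdot x y ^+ 2.

(** For skew [A] this is $AX + XA^T$, the infinitesimal action of so(n) on bivectors. *)
Definition ad (F : pzRingType) n (A X : 'M[F]_n) : 'M[F]_n := A *m X - X *m A.

Section HermitianForm.
Variables (C : numClosedFieldType) (n : nat).
Implicit Types (r : tensor4 C n) (X Y A : 'M[C]_n) (x y : 'rV[C]_n).

(** The arguments are arbitrary matrices: an [r] antisymmetric in each pair sees only their
    antisymmetric parts, so the rank-one matrix [x^T *m y] can stand for x /\ y. *)
Definition tform r X Y : C :=
  \sum_i \sum_j \sum_k \sum_l r i j k l * X i j * (Y k l)^*.

Lemma tformDl r X1 X2 Y : tform r (X1 + X2) Y = tform r X1 Y + tform r X2 Y.
Proof.
rewrite /tform; do 4!(rewrite -big_split /=; apply: eq_bigr => ? _).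
by rewrite mxE; ring.
Qed.

Lemma tformZl r c X Y : tform r (c *: X) Y = c * tform r X Y.
Proof.
rewrite /tform; do 4!(rewrite mulr_sumr; apply: eq_bigr => ? _).
by rewrite mxE; ring.
Qed.

Lemma tformDr r X Y1 Y2 : tform r X (Y1 + Y2) = tform r X Y1 + tform r X Y2.
Proof.
rewrite /tform; do 4!(rewrite -big_split /=; apply: eq_bigr => ? _).
by rewrite mxE rmorphD /=; ring.
Qed.

Lemma tformZr r c X Y : tform r X (c *: Y) = c^* * tform r X Y.
Proof.
rewrite /tform; do 4!(rewrite mulr_sumr; apply: eq_bigr => ? _).
by rewrite mxE rmorphM /=; ring.
Qed.

Lemma tformNl r X Y : tform r (- X) Y = - tform r X Y.
Proof. by rewrite -scaleN1r tformZl mulN1r. Qed.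

Lemma tformNr r X Y : tform r X (- Y) = - tform r X Y.
Proof. by rewrite -scaleN1r tformZr rmorphN1 mulN1r. Qed.

Lemma tform_suml r (I : finType) (F : I -> 'M[C]_n) Y :
  tform r (\sum_a F a) Y = \sum_a tform r (F a) Y.
Proof.
apply: (big_morph (fun X => tform r X Y)) => [X1 X2|]; first exact: tformDl.
by rewrite -(scale0r 0) tformZl mul0r.
Qed.

Lemma tform_sumr r (I : finType) X (F : I -> 'M[C]_n) :
  tform r X (\sum_a F a) = \sum_a tform r X (F a).
Proof.
apply: (big_morph (tform r X)) => [X1 X2|]; first exact: tformDr.
by rewrite -(scale0r 0) tformZr rmorph0 mul0r.
Qed.

Lemma tform_trl r X Y : curvature_symmetries r ->
  tform r X^T Y = - tform r X Y.
Proof.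
case=> r1 _ _; rewrite /tform exchange_big -sumrN; apply: eq_bigr => i _.
rewrite -sumrN; apply: eq_bigr => j _; rewrite -sumrN; apply: eq_bigr => k _.
rewrite -sumrN; apply: eq_bigr => l _.
by rewrite mxE r1; ring.
Qed.

Lemma tform_trr r X Y : curvature_symmetries r ->
  tform r X Y^T = - tform r X Y.
Proof.
case=> _ r2 _; rewrite /tform -sumrN; apply: eq_bigr => i _.
rewrite -sumrN; apply: eq_bigr => j _; rewrite exchange_big -sumrN.
apply: eq_bigr => k _; rewrite -sumrN; apply: eq_bigr => l _.
by rewrite mxE r2; ring.
Qed.

Lemma tform_subtr r X : curvature_symmetries r ->
  tform r (X^T - X) (X^T - X) = 4 * tform r X X.
Proof.
move=> sr; rewrite !(tformDl, tformDr, tformNl, tformNr) !(tform_trl, tform_trr) //.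
by ring.
Qed.

Lemma tform_conj r X Y : curvature_symmetries r ->
  (forall i j k l, (r i j k l)^* = r i j k l) ->
  tform r Y X = (tform r X Y)^*.
Proof.
case=> _ _ r3 rR; rewrite /tform !rmorph_sum /=.
rewrite (eq_bigr (fun i => \sum_k \sum_j \sum_l r i j k l * Y i j * (X k l)^*));
  last by move=> i _; rewrite exchange_big.
rewrite exchange_big; apply: eq_bigr => k _.
rewrite rmorph_sum /=.
under eq_bigr do rewrite exchange_big /=.
rewrite exchange_big; apply: eq_bigr => l _ /=.
rewrite rmorph_sum /=; apply: eq_bigr => i _.
rewrite rmorph_sum /=; apply: eq_bigr => j _.
by rewrite !rmorphM /= conjCK rR r3; ring.
Qed.

Lemma cdotC x y : cdot x y = cdot y x.
Proof. by rewrite /cdot -[in LHS](trmxK x) -trmx_mul mxE. Qed.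

End HermitianForm.

(** * Second variation under the complex orthogonal group *)

Lemma ge0_of_linear_dominates (C : numFieldType) (a b : C) :
  a \is Num.real -> 0 <= b ->
  (forall w, 0 < w -> w <= 1 -> 0 <= w * a + w ^+ 2 * b) -> 0 <= a.
Proof.
move=> ra b0 H; rewrite real_leNgt ?real0 //; apply/negP => a0.
have d0 : 0 < b - a by rewrite subr_gt0 (lt_le_trans a0).
(* If [a < 0], this value of [w] lies in (0, 1] and gives $a + wb = -a^2/(b-a) < 0$. *)
have w0 : 0 < - a / (b - a) by rewrite divr_gt0 // oppr_gt0.
have w1 : - a / (b - a) <= 1 by rewrite ler_pdivrMr // mul1r lerDr.
have := H _ w0 w1; rewrite expr2 -mulrA -mulrDr pmulr_rge0 //.
have -> : a + - a / (b - a) * b = - (a ^+ 2 / (b - a)).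
  by field; rewrite gt_eqF.
rewrite oppr_ge0 => /le_gtF; rewrite divr_gt0 //.
by rewrite real_exprn_even_gt0 // (lt_eqF a0) orbT.
Qed.

Section SecondVariation.
Variables (C : numClosedFieldType) (n : nat).
Implicit Types (r : tensor4 C n) (X Y A : 'M[C]_n) (x y : 'rV[C]_n).

Lemma tform_parallelogram r X Y :
  tform r (X + Y) (X + Y) + tform r (X - Y) (X - Y)
  = 2 * (tform r X X + tform r Y Y).
Proof. by rewrite !(tformDl, tformDr, tformNl, tformNr); ring. Qed.

Lemma tform_i r X : tform r ('i *: X) ('i *: X) = tform r X X.
Proof.
by rewrite tformZl tformZr conjCi mulrA mulrN -expr2 sqrCi opprK mul1r.
Qed.

Lemma tform_real r X : curvature_symmetries r ->
  (forall i j k l, (r i j k l)^* = r i j k l) -> tform r X X \is Num.real.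
Proof. by move=> sr rR; apply/CrealP; rewrite -tform_conj. Qed.

(** Parseval for the fourth roots of unity: the four arguments are $X + \omega Y + \omega^2 Z +
    \omega^3 W$ with $\omega^4 = 1$, and the mixed terms cancel. *)
Lemma tform_fourier r X Y Z W :
  tform r (X + Z + (Y + W)) (X + Z + (Y + W))
  + tform r (X + Z - (Y + W)) (X + Z - (Y + W))
  + (tform r (X - Z + 'i *: (Y - W)) (X - Z + 'i *: (Y - W))
     + tform r (X - Z - 'i *: (Y - W)) (X - Z - 'i *: (Y - W)))
  = 4 * (tform r X X + tform r Y Y + tform r Z Z + tform r W W).
Proof.
rewrite !tform_parallelogram tform_i.
have := tform_parallelogram r X Z; have := tform_parallelogram r Y W.
set a := tform r (X + Z) _; set b := tform r (X - Z) _.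
set c := tform r (Y + W) _; set d := tform r (Y - W) _ => h1 h2.
transitivity (2 * ((a + b) + (c + d))); first by ring.
by rewrite h1 h2; ring.
Qed.

(* Taylor polynomial of [exp (- s A)]: for skew [A] it preserves [cdot] up to
   order [s^4], which suffices for second variations. *)
Definition exp2 (s : C) A : 'M[C]_n := 1%:M - s *: A + (s ^+ 2 / 2) *: (A *m A).

Lemma exp2_tr s A : A^T = - A ->
  (exp2 s A)^T = 1%:M + s *: A + (s ^+ 2 / 2) *: (A *m A).
Proof.
move=> sA; rewrite /exp2 !(raddfD, raddfN) /= !linearZ /= trmx_mul sA trmx1.
by rewrite mulNmx mulmxN !opprK.
Qed.

(** A difference of squares: $(1 + s^2A^2/2)^2 - (sA)^2$, where the terms of order $s^2$ cancel. *)
Lemma exp2_mul_tr s A : A^T = - A ->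
  exp2 s A *m (exp2 s A)^T = 1%:M + s ^+ 4 *: (4^-1 *: (A *m A *m (A *m A))).
Proof.
move=> sA; rewrite exp2_tr // /exp2.
rewrite !(mulmxDl, mulmxDr, mulmx1, mul1mx, mulNmx, mulmxN).
rewrite -!(scalemxAl, scalemxAr) !scalerA !mulmxA.
set B := A *m A *m A *m A; set D := A *m A *m A; set E := A *m A.
have -> : s ^+ 2 / 2 * (s ^+ 2 / 2) = s ^+ 4 / 4 by field.
have -> : s * (s ^+ 2 / 2) = s ^+ 2 / 2 * s by ring.
rewrite [(s ^+ 2 / 2 * s) *: D]lock.
have -> : s * s = s ^+ 2 / 2 + s ^+ 2 / 2 by field.
rewrite scalerDl.
apply/matrixP => i j; rewrite !mxE.
by ring.
Qed.

(** The powers of [s] are grouped by residue modulo 4, as [tform_fourier] requires; the term of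
    order 1 is the infinitesimal action [ad A X]. *)
Lemma exp2_conj s A X : A^T = - A ->
  (exp2 s A)^T *m X *m exp2 s A =
  X + s ^+ 4 *: (4^-1 *: (A *m A *m X *m A *m A))
  + s ^+ 2 *: (2^-1 *: (A *m A *m X) - A *m X *m A + 2^-1 *: (X *m A *m A))
  + (s *: ad A X
     + s ^+ 3 *: (2^-1 *: (A *m X *m A *m A) - 2^-1 *: (A *m A *m X *m A))).
Proof.
move=> sA; rewrite exp2_tr // /exp2 /ad.
rewrite !(mulmxDl, mulmxDr, mulmx1, mul1mx, mulNmx, mulmxN).
rewrite -!(scalemxAl, scalemxAr) !scalerA !mulmxA.
move: (A *m A *m X *m A *m A) (A *m A *m X) (A *m X *m A) (X *m A *m A).
move: (A *m X *m A *m A) (A *m A *m X *m A) (A *m X) (X *m A).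
move=> B1 B2 B3 B4 B5 B6 B7 B8; apply/matrixP => i j; rewrite !mxE.
by field.
Qed.

Lemma cdot_exp2 s A x y : A^T = - A ->
  cdot (x *m exp2 s A) (y *m exp2 s A) =
  cdot x y + s ^+ 4 * cdot x (y *m (4^-1 *: (A *m A *m (A *m A)))^T).
Proof.
move=> sA; rewrite /cdot !trmx_mul trmxK !mulmxA -(mulmxA x) exp2_mul_tr //.
by rewrite mulmxDr mulmx1 mulmxDl -scalemxAr -scalemxAl !mulmxA mxE [X in _ + X]mxE.
Qed.

Definition gram2_nonneg r := forall x y,
  0 <= tform r (x^T *m y) (x^T *m y) + `|gram2 x y|.

(** [g1] and [g2] do not depend on [s]. Since the change is of order $s^4$, the triangle inequality
    alone controls the modulus, even where [gram2 x y] vanishes. *)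
Lemma gram2_exp2 A x y : A^T = - A -> exists g1 g2 : C, forall s,
  gram2 (x *m exp2 s A) (y *m exp2 s A)
  = gram2 x y + s ^+ 4 * g1 + (s ^+ 4) ^+ 2 * g2.
Proof.
move=> sA; set B := (4^-1 *: (A *m A *m (A *m A)))^T.
exists (cdot x x * cdot y (y *m B) + cdot x (x *m B) * cdot y y
        - 2 * cdot x y * cdot x (y *m B)).
exists (cdot x (x *m B) * cdot y (y *m B) - cdot x (y *m B) ^+ 2).
by move=> s; rewrite /gram2 !cdot_exp2 //; ring.
Qed.

(* Averaging over [s, -s, i s, -i s] keeps, up to order [s^4], only the
   terms [tform r X X] and [s^2 tform r (ad A X) (ad A X)]. *)
Lemma second_variation r x y A : curvature_symmetries r ->
  (forall i j k l, (r i j k l)^* = r i j k l) -> gram2_nonneg r ->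
  tform r (x^T *m y) (x^T *m y) + `|gram2 x y| = 0 -> A^T = - A ->
  0 <= tform r (ad A (x^T *m y)) (ad A (x^T *m y)).
Proof.
move=> sr rR rge0 req0 sA; have [g1 [g2 gE]] := gram2_exp2 x y sA.
set X := x^T *m y in req0 *.
pose X2 := 2^-1 *: (A *m A *m X) - A *m X *m A + 2^-1 *: (X *m A *m A).
pose X3 := 2^-1 *: (A *m X *m A *m A) - 2^-1 *: (A *m A *m X *m A).
pose X4 := 4^-1 *: (A *m A *m X *m A *m A).
pose f := tform r.
have fR Y : f Y Y \is Num.real by exact: tform_real.
have f04 : f X X4 + f X4 X \is Num.real.
  by apply/CrealP; rewrite rmorphD /= -!tform_conj // addrC.
have f_s s : 0 <= f (X + s ^+ 4 *: X4 + s ^+ 2 *: X2 + (s *: ad A X + s ^+ 3 *: X3))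
      (X + s ^+ 4 *: X4 + s ^+ 2 *: X2 + (s *: ad A X + s ^+ 3 *: X3))
    + `|gram2 x y + s ^+ 4 * g1 + (s ^+ 4) ^+ 2 * g2|.
  by have := rge0 (x *m exp2 s A) (y *m exp2 s A);
    rewrite gE trmx_mul mulmxA -(mulmxA _ x^T) exp2_conj.
(* With $w = s^2$, the averaged inequality has linear coefficient [tform r (ad A X) (ad A X)]. The
   constant adds the absolute values of all coefficients of $w^2$ and higher powers, each power
   being at most $w^2$ on (0, 1]. *)
apply: (@ge0_of_linear_dominates _ _
  (`|f X2 X2| + `|f X3 X3| + `|f X X4 + f X4 X| + `|f X4 X4| + `|g1| + `|g2|)).
- exact: fR.
- by rewrite !addr_ge0.
move=> w w0 w1; pose s := sqrtC w.
have s2 : s ^+ 2 = w by exact: sqrtCK.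
have s4 : s ^+ 4 = w ^+ 2 by rewrite -s2 -exprM.
have sR : s^* = s by apply: conj_Creal; rewrite ger0_real // sqrtC_ge0 ltW.
have i2 : 'i * 'i = -1 :> C by rewrite -expr2 sqrCi.
(* All four points share the value $s^4 = w^2$, hence also the same [gram2], so the modulus term [G]
   is common to the four inequalities. *)
have := f_s s; have := f_s (- s); have := f_s ('i * s); have := f_s (- ('i * s)).
have -> : (- s) ^+ 4 = w ^+ 2 by rewrite -s4; ring.
have -> : (- ('i * s)) ^+ 4 = w ^+ 2.
  by rewrite -s4; transitivity (('i * 'i) ^+ 2 * s ^+ 4); [ring | rewrite i2; ring].
have -> : ('i * s) ^+ 4 = w ^+ 2.
  by rewrite -s4; transitivity (('i * 'i) ^+ 2 * s ^+ 4); [ring | rewrite i2; ring].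
rewrite s4.
have -> : (- s) ^+ 2 = w by rewrite -s2; ring.
have -> : (- ('i * s)) ^+ 2 = - w.
  by rewrite -s2; transitivity (('i * 'i) * s ^+ 2); [ring | rewrite i2; ring].
have -> : ('i * s) ^+ 2 = - w.
  by rewrite -s2; transitivity (('i * 'i) * s ^+ 2); [ring | rewrite i2; ring].
rewrite s2.
have -> : ('i * s) ^+ 3 = - ('i * s ^+ 3).
  by transitivity ('i * 'i * ('i * s ^+ 3)); [ring | rewrite i2; ring].
have -> : (- ('i * s)) ^+ 3 = 'i * s ^+ 3.
  by transitivity (- ('i * 'i * ('i * s ^+ 3))); [ring | rewrite i2; ring].
have -> : (- s) ^+ 3 = - s ^+ 3 by ring.
set G := `|_|; set E := X + _.
have -> : E + w *: X2 + (- s *: ad A X + - s ^+ 3 *: X3)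
  = E + w *: X2 - (s *: ad A X + s ^+ 3 *: X3) by rewrite !scaleNr opprD.
have -> : E + - w *: X2 + ('i * s *: ad A X + - ('i * s ^+ 3) *: X3)
  = E - w *: X2 + 'i *: (s *: ad A X - s ^+ 3 *: X3).
  by rewrite !scaleNr (scalerBr 'i) !(scalerA 'i).
have -> : E + - w *: X2 + (- ('i * s) *: ad A X + 'i * s ^+ 3 *: X3)
  = E - w *: X2 - 'i *: (s *: ad A X - s ^+ 3 *: X3).
  by rewrite !scaleNr (scalerBr 'i) !(scalerA 'i) opprB [- _ + _]addrC.
move=> h1 h2 h3 h4; have := addr_ge0 (addr_ge0 h4 h3) (addr_ge0 h2 h1).
rewrite (_ : forall a b c d : C, a + G + (b + G) + (c + G + (d + G))
  = a + b + (c + d) + 4 * G); last by move=> *; ring.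
rewrite tform_fourier -mulrDr pmulr_rge0 ?ltr0n // => {h1 h2 h3 h4} h.
apply: le_trans h _; rewrite -!/(f _ _).
have -> : f E E = f X X + w ^+ 2 * (f X X4 + f X4 X) + w ^+ 4 * f X4 X4.
  have wR : (w ^+ 2)^* = w ^+ 2 by rewrite conj_Creal // ger0_real // exprn_ge0 // ltW.
  by rewrite /f !(tformDl, tformDr, tformZl, tformZr) wR; ring.
have -> : f (s *: ad A X) (s *: ad A X) = w * f (ad A X) (ad A X).
  by rewrite /f tformZl tformZr sR mulrA -expr2 s2.
have -> : f (w *: X2) (w *: X2) = w ^+ 2 * f X2 X2.
  by rewrite /f tformZl tformZr conj_Creal ?mulrA -?expr2 // ger0_real // ltW.
have -> : f (s ^+ 3 *: X3) (s ^+ 3 *: X3) = w ^+ 3 * f X3 X3.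
  by rewrite /f tformZl tformZr rmorphXn /= sR mulrA -s2; congr (_ * _); ring.
have GE : G <= `|gram2 x y| + w ^+ 2 * `|g1| + w ^+ 2 * `|g2|.
  rewrite /G; apply: le_trans (ler_normD _ _) _.
  apply: lerD; first apply: le_trans (ler_normD _ _) _.
    by rewrite lerD2l normrM ger0_norm // exprn_ge0 // ltW.
  rewrite normrM; apply: ler_wpM2r => //; rewrite ger0_norm; last first.
    by rewrite !exprn_ge0 // ltW.
  by rewrite -exprM ler_wiXn2l // ltW.
have bnd (k : nat) (a : C) : (2 <= k)%N -> a \is Num.real ->
    w ^+ k * a <= w ^+ 2 * `|a|.
  move=> k2 ra; apply: (@le_trans _ _ (w ^+ k * `|a|)).
    by apply: ler_wpM2l; [rewrite exprn_ge0 // ltW | exact: real_ler_norm].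
  by apply: ler_wpM2r => //; rewrite ler_wiXn2l // ltW.
set a1 := w * _.
have := bnd 2 _ isT (fR X2); have := bnd 3 _ isT (fR X3).
have := bnd 2 _ isT f04; have := bnd 4 _ isT (fR X4); move=> b1 b2 b3 b4.
have := lerD (lerD (lerD (lerD b1 b2) (lerD b3 b4)) GE) (lexx (f X X + a1)).
rewrite -subr_ge0 => b; rewrite -subr_ge0; apply: le_trans b _.
rewrite le_eqVlt; apply/orP; left; apply/eqP.
(* The vanishing at [x], [y] cancels the terms of order zero. *)
by rewrite -/f in req0; rewrite -[RHS]addr0 -req0; ring.
Qed.

End SecondVariation.

(** * The trace of the second-variation form against the curvature tensor *)

Section ReactionTerm.
Variables (C : numClosedFieldType) (n : nat).
Implicit Types (r : tensor4 C n) (X Y A : 'M[C]_n) (x y : 'rV[C]_n).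
Implicit Types (u v : 'I_n * 'I_n).

Lemma adDl A B X : ad (A + B) X = ad A X + ad B X.
Proof. by rewrite /ad mulmxDl mulmxDr opprD addrACA. Qed.

Lemma adZl c A X : ad (c *: A) X = c *: ad A X.
Proof. by rewrite /ad -scalemxAl -scalemxAr scalerBr. Qed.

Lemma adNl A X : ad (- A) X = - ad A X.
Proof. by rewrite -scaleN1r adZl scaleN1r. Qed.

Lemma ad_suml (I : finType) (F : I -> 'M[C]_n) X :
  ad (\sum_a F a) X = \sum_a ad (F a) X.
Proof.
apply: (big_morph (fun A => ad A X)) => [A B|]; first exact: adDl.
by rewrite -(scale0r 0) adZl !scale0r.
Qed.

Definition wedge u : 'M[C]_n := delta_mx u.1 u.2 - delta_mx u.2 u.1.

Lemma wedge_tr u : (wedge u)^T = - wedge u.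
Proof. by rewrite /wedge linearB /= !trmx_delta opprB. Qed.

Lemma tform_pairs r X Y :
  tform r X Y = \sum_u \sum_v r u.1 u.2 v.1 v.2 * X u.1 u.2 * (Y v.1 v.2)^*.
Proof.
rewrite /tform pair_big; apply: eq_bigr => -[i j] _ /=.
by rewrite pair_big; apply: eq_bigr => -[k l] _.
Qed.

Lemma ad_deltaE p q X i j :
  ad (delta_mx p q) X i j = (i == p)%:R * X q j - X i p * (j == q)%:R.
Proof.
rewrite /ad !mxE (bigD1 q) //= big1 ?addr0; last first.
  by move=> k kq; rewrite mxE (negPf kq) andbF mul0r.
rewrite (bigD1 p) //= big1 ?addr0; last first.
  by move=> k kp; rewrite mxE (negPf kp) mulr0.
by rewrite !mxE !eqxx andbT.
Qed.

Lemma sum_ad_delta (L : 'M[C]_n) X p q :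
  \sum_u L u.1 u.2 * ad (delta_mx p q) X u.1 u.2
  = (L *m X^T) p q - (X^T *m L) p q.
Proof.
rewrite -(pair_big predT predT (fun i j => L i j * ad (delta_mx p q) X i j)) /=.
under eq_bigr => i _ do under eq_bigr => j _ do rewrite ad_deltaE mulrBr.
under eq_bigr => i _ do rewrite sumrB.
rewrite sumrB (bigD1 p) //= [X in _ + X - _]big1 ?addr0; last first.
  by move=> i /negPf ->; apply: big1 => j _; rewrite mul0r mulr0.
rewrite !mxE; congr (_ - _).
  by apply: eq_bigr => j _; rewrite eqxx mul1r mxE.
apply: eq_bigr => i _; rewrite (bigD1 q) //= big1 ?addr0; last first.
  by move=> j /negPf ->; rewrite !mulr0.
by rewrite eqxx mulr1 mulrC mxE.
Qed.

(** Invariance of the trace pairing: the commutator with [X] moves from the wedge onto [L]. This is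
    how eigenvectors acquire the form [ad L X]. *)
Lemma sum_ad_wedge (L : 'M[C]_n) X p q : L^T = - L ->
  \sum_u L u.1 u.2 * ad (wedge (p, q)) X u.1 u.2
  = ((ad L X)^T - ad L X) p q.
Proof.
move=> sL; rewrite /wedge /=.
have -> : ad L X = L *m X - X *m L by [].
under eq_bigr => u _ do rewrite adDl adNl mxE [X in _ * (_ + X)]mxE mulrBr.
rewrite sumrB !sum_ad_delta [(_ - _)^T]linearB /= !trmx_mul sL mulNmx mulmxN opprK.
have tr_entry (M : 'M[C]_n) : M q p = M^T p q by rewrite mxE.
rewrite (tr_entry (_ *m _)) (tr_entry (X^T *m _)) !trmx_mul trmxK sL.
by rewrite mulmxN mulNmx !mxE; ring.
Qed.

Section Spectral.
Variables (r : tensor4 C n) (X : 'M[C]_n).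
Hypothesis sr : curvature_symmetries r.
Hypothesis rR : forall i j k l, (r i j k l)^* = r i j k l.
Hypothesis r_ad : forall A, A^T = - A -> 0 <= tform r (ad A X) (ad A X).

(* The eigenvectors of the matrix [H] of [A |-> r (ad A X) (ad A X)] for nonzero
   eigenvalues are, up to conjugation and antisymmetrization, again of the form
   [ad L X]; the sum is the trace of [H] against [r]. *)
Lemma sum_ad_wedge_ge0 :
  0 <= \sum_u \sum_v r u.1 u.2 v.1 v.2
         * tform r (ad (wedge u) X) (ad (wedge v) X).
Proof.
(* The pairs are enumerated by an ordinal so that the spectral theorem for matrices applies; ordered
   pairs are used, so each wedge occurs with both signs. *)
pose N := #|{: 'I_n * 'I_n}|; pose e : 'I_N -> 'I_n * 'I_n := @enum_val _ _.
pose Z (a : 'I_N) := ad (wedge (e a)) X.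
pose H : 'M[C]_N := \matrix_(a, b) tform r (Z a) (Z b).
have Hherm : H \is hermsymmx.
  apply/is_hermitianmxP; rewrite expr0 scale1r; apply/matrixP => a b.
  by rewrite !mxE tform_conj.
have /orthomx_spectralP := hermitian_normalmx Hherm.
have := hermitian_spectral_diag_real Hherm.
have := spectral_unitarymx H.
move: (spectralmx H) (spectral_diag H) => P d Pu dR.
rewrite invmx_unitary // => HE.
have PH : P *m H = diag_mx d *m P.
  by rewrite HE !mulmxA; move/unitarymxP: Pu => ->; rewrite mul1mx.
(* [W k] is the image under [ad _ X] of the [k]-th eigenvector. The eigenvalue equation becomes
   [dP], and unitarity of [P] then gives [d 0 k] as the value of [tform r] at [W k]. *)
pose W k := ad (\sum_a P k a *: wedge (e a)) X.
have WE k : W k = \sum_a P k a *: Z a.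
  by rewrite /W ad_suml; apply: eq_bigr => a _; rewrite adZl.
have W_ge0 k : 0 <= tform r (W k) (W k).
  apply: r_ad; rewrite raddf_sum -sumrN; apply: eq_bigr => a _.
  by rewrite /= linearZ /= wedge_tr scalerN.
have dP k b : d 0 k * P k b = tform r (W k) (Z b).
  move/matrixP/(_ k b): PH; rewrite mul_diag_mx !mxE => <-.
  by rewrite WE tform_suml; apply: eq_bigr => a _; rewrite mxE tformZl.
have d_ge0 k : 0 <= d 0 k.
  suff -> : d 0 k = tform r (W k) (W k) by [].
  rewrite [X in tform r _ X]WE tform_sumr.
  under eq_bigr => b _ do rewrite tformZr -dP mulrCA.
  rewrite -mulr_sumr -[LHS]mulr1; congr (_ * _).
  move/unitarymxP/matrixP/(_ k k): Pu.
  rewrite [in X in _ = X -> _]mxE eqxx mulr1n => <-; rewrite mxE.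
  by apply: eq_bigr => b _; rewrite !mxE mulrC.
pose Pi k : 'M[C]_n := \matrix_(i, j) (P k (enum_rank (i, j)))^*.
(* By [dP], each entry of the scaled eigenvector pairs [W k] with a commutator. Contracting [r] with
   the conjugate of [W k] gives the skew matrix [L], and [sum_ad_wedge] concludes. *)
have dPi k : d 0 k *: Pi k =
    (ad (\matrix_(i, j) \sum_v r i j v.1 v.2 * (W k v.1 v.2)^*) X)^T
    - ad (\matrix_(i, j) \sum_v r i j v.1 v.2 * (W k v.1 v.2)^*) X.
  set L := \matrix_(i, j) _.
  have sL : L^T = - L.
    apply/matrixP => i j; rewrite !mxE -sumrN; apply: eq_bigr => v _.
    by case: sr => -> _ _; rewrite mulNr.
  apply/matrixP => i j; rewrite -sum_ad_wedge // !mxE.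
  have {1}<- : (d 0 k)^* = d 0 k by rewrite conj_Creal // ger0_real.
  rewrite -rmorphM /= dP /Z /e enum_rankK -tform_conj // tform_pairs.
  apply: eq_bigr => u _; rewrite [L _ _]mxE mulr_suml.
  by apply: eq_bigr => v _; ring.
have Pi_ge0 k : 0 <= d 0 k * tform r (Pi k) (Pi k).
  (* An eigenvector in the kernel need not have the form [ad L X], but its weight in the trace is
     zero. *)
  have [->|dk0] := eqVneq (d 0 k) 0; first by rewrite mul0r.
  have dk_gt0 : 0 < d 0 k by rewrite lt_def dk0 d_ge0.
  have dkR : (d 0 k)^* = d 0 k by rewrite conj_Creal // ger0_real.
  rewrite -(pmulr_rge0 _ dk_gt0) mulrA -{2}dkR -mulrA -tformZr -tformZl dPi.
  rewrite tform_subtr // pmulr_rge0 ?ltr0n //; apply: r_ad.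
  apply/matrixP => i j; rewrite !mxE -sumrN; apply: eq_bigr => v _.
  by case: sr => -> _ _; rewrite mulNr.
have -> : \sum_u \sum_v r u.1 u.2 v.1 v.2
         * tform r (ad (wedge u) X) (ad (wedge v) X)
  = \sum_k d 0 k * tform r (Pi k) (Pi k); last exact: sumr_ge0.
have HEab a b : tform r (Z a) (Z b) = \sum_k (P k a)^* * d 0 k * P k b.
  move/matrixP/(_ a b): HE; rewrite -mulmxA mul_diag_mx !mxE => ->.
  by apply: eq_bigr => k _; rewrite !mxE mulrA.
transitivity (\sum_u \sum_v \sum_k r u.1 u.2 v.1 v.2
    * ((P k (enum_rank u))^* * d 0 k * P k (enum_rank v))).
  apply: eq_bigr => u _; apply: eq_bigr => v _.
  by rewrite -mulr_sumr -HEab /Z /e !enum_rankK.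
under eq_bigr => u _ do rewrite exchange_big.
rewrite exchange_big; apply: eq_bigr => k _ /=.
rewrite tform_pairs mulr_sumr; apply: eq_bigr => u _.
rewrite mulr_sumr; apply: eq_bigr => v _.
by rewrite !mxE conjCK -!surjective_pairing; ring.
Qed.
End Spectral.
End ReactionTerm.

(** * Nonnegativity of the reaction term *)

Section QForm.
Variables (C : numClosedFieldType) (n : nat).
Implicit Types (r : tensor4 C n) (X Y A : 'M[C]_n) (x y : 'rV[C]_n).
Implicit Types (u v : 'I_n * 'I_n).

Let T6 := ('I_n * 'I_n * 'I_n * 'I_n * 'I_n * 'I_n)%type.

Lemma sum6_reindex (s t : T6 -> T6) (F : T6 -> C) : cancel s t -> cancel t s ->
  \sum_a \sum_b \sum_c \sum_d \sum_e \sum_f F (a, b, c, d, e, f)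
  = \sum_a \sum_b \sum_c \sum_d \sum_e \sum_f F (s (a, b, c, d, e, f)).
Proof.
move=> st ts.
have sum6 (G : T6 -> C) :
    \sum_a \sum_b \sum_c \sum_d \sum_e \sum_f G (a, b, c, d, e, f) = \sum_z G z.
  by rewrite !pair_bigA /=; apply: eq_bigr => -[[[[[? ?] ?] ?] ?] ?] _.
rewrite (sum6 F) (sum6 (F \o s)) (reindex s) //.
by exists t => z _; [exact: st | exact: ts].
Qed.

Lemma ad_delta_sum p q X :
  ad (delta_mx p q) X
  = \sum_j X q j *: delta_mx p j - \sum_i X i p *: delta_mx i q.
Proof.
apply/matrixP => i j; rewrite ad_deltaE 2!mxE !summxE.
rewrite (bigD1 j) //= big1 => [|k kj]; last first.
  by rewrite !mxE [j == k]eq_sym (negPf kj) andbF mulr0.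
rewrite [X in _ = _ - X](bigD1 i) //= [X in _ = _ - (_ + X)]big1 => [|k ki].
  by rewrite !mxE !eqxx andbT !addr0 [_ * X q j]mulrC.
by rewrite !mxE [i == k]eq_sym (negPf ki) ?mulr0.
Qed.

Lemma tform_delta r i j k l : tform r (delta_mx i j) (delta_mx k l) = r i j k l.
Proof.
rewrite tform_pairs (bigD1 (i, j)) //= [X in _ + X]big1; last first.
  move=> [a b]; rewrite xpair_eqE => /negPf ne; apply: big1 => v _.
  by rewrite mxE ne mulr0 mul0r.
rewrite (bigD1 (k, l)) //= [X in _ + X + _]big1; last first.
  move=> [a b]; rewrite xpair_eqE => /negPf ne.
  by rewrite [X in _ * X^*]mxE ne rmorph0 mulr0.
by rewrite !mxE !eqxx /= conjC1 !mulr1 !addr0.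
Qed.

Lemma tform_ad_delta r X p q s t :
  tform r (ad (delta_mx p q) X) (ad (delta_mx s t) X)
  = \sum_a \sum_b (X q a * (X t b)^* * r p a s b - X q a * (X b s)^* * r p a b t
                   - X a p * (X t b)^* * r a q s b + X a p * (X b s)^* * r a q b t).
Proof.
have tsum (F G : 'I_n -> C) (c d : 'I_n -> 'I_n * 'I_n) :
    tform r (\sum_a F a *: delta_mx (c a).1 (c a).2)
            (\sum_b G b *: delta_mx (d b).1 (d b).2)
    = \sum_a \sum_b F a * (G b)^* * r (c a).1 (c a).2 (d b).1 (d b).2.
  rewrite tform_suml; apply: eq_bigr => a _.
  rewrite tformZl tform_sumr mulr_sumr; apply: eq_bigr => b _.
  by rewrite tformZr tform_delta mulrA.
rewrite !ad_delta_sum tformDl tformNl !tformDr !tformNr opprD opprK addrA.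
rewrite (tsum _ _ (fun j => (p, j)) (fun j => (s, j))).
rewrite (tsum _ _ (fun j => (p, j)) (fun j => (j, t))).
rewrite (tsum _ _ (fun j => (j, q)) (fun j => (s, j))).
rewrite (tsum _ _ (fun j => (j, q)) (fun j => (j, t))) /=.
rewrite -!sumrB -!big_split /=; apply: eq_bigr => a _.
rewrite -!sumrB -!big_split /=; apply: eq_bigr => b _.
by ring.
Qed.

Definition swap u := (u.2, u.1).

Lemma sum_antisym (c G : 'I_n * 'I_n -> C) : (forall u, c (swap u) = - c u) ->
  \sum_u c u * (G u - G (swap u)) = 2 * \sum_u c u * G u.
Proof.
move=> cN; under eq_bigr do rewrite mulrBr; rewrite sumrB mulr_natl mulr2n.
congr (_ + _); rewrite (reindex swap) /=; last by exists swap => -[].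
by rewrite -sumrN; apply: eq_bigr => -[p q] _; rewrite cN mulNr opprK.
Qed.

(** Each wedge is an antisymmetrized elementary matrix, and pairing with the antisymmetric [r]
    doubles it; two slots give the factor 4. *)
Lemma sum_ad_wedge_delta r X : curvature_symmetries r ->
  \sum_u \sum_v r u.1 u.2 v.1 v.2 * tform r (ad (wedge C u) X) (ad (wedge C v) X)
  = 4 * \sum_u \sum_v r u.1 u.2 v.1 v.2
          * tform r (ad (delta_mx u.1 u.2) X) (ad (delta_mx v.1 v.2) X).
Proof.
case=> r1 r2 _; pose D u := ad (delta_mx u.1 u.2) X.
transitivity (\sum_u \sum_v 2 * (r u.1 u.2 v.1 v.2 * tform r (ad (wedge C u) X) (D v))).
  apply: eq_bigr => u _; rewrite -mulr_sumr -sum_antisym; last first.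
    by move=> v; rewrite /= r2.
  by apply: eq_bigr => v _; rewrite [X in tform r _ X]adDl adNl tformDr tformNr.
rewrite exchange_big; under [in RHS]eq_bigr do rewrite -/(D _).
rewrite [in RHS]exchange_big mulr_sumr; apply: eq_bigr => v _.
have := @sum_antisym (fun u => r u.1 u.2 v.1 v.2) (fun u => tform r (D u) (D v)).
move=> /(_ (fun u => r1 _ _ _ _)) h.
have e4 : 4 = 2 * 2 :> C by rewrite -natrM.
rewrite -mulr_sumr e4 -mulrA -h.
congr (_ * _); apply: eq_bigr => u _.
by rewrite [X in tform r X _]adDl adNl tformDl tformNl.
Qed.

(** Up to normalization, Hamilton's splitting of the reaction term into the square of the curvature
    operator and the sharp product built from the Lie bracket. *)
Lemma tform_Qtensor r X : curvature_symmetries r ->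
  (forall i j k l, (r i j k l)^* = r i j k l) ->
  tform (Qtensor r) X X
  = \sum_p \sum_q `|\sum_i \sum_j r i j p q * X i j| ^+ 2
    + \sum_u \sum_v r u.1 u.2 v.1 v.2
        * tform r (ad (delta_mx u.1 u.2) X) (ad (delta_mx v.1 v.2) X).
Proof.
move=> [r1 r2 r3] rR.
pose S (F : 'I_n -> 'I_n -> 'I_n -> 'I_n -> 'I_n -> 'I_n -> C) :=
  \sum_i \sum_j \sum_k \sum_l \sum_p \sum_q F i j k l p q.
have SD F G : S F + S G = S (fun i j k l p q => F i j k l p q + G i j k l p q).
  by rewrite /S; do 6!(rewrite -big_split; apply: eq_bigr => ? _).
have eqS F G : (forall i j k l p q, F i j k l p q = G i j k l p q) -> S F = S G.
  by move=> FG; rewrite /S; do 6!(apply: eq_bigr => ? _); rewrite FG.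
have QE : tform (Qtensor r) X X
  = S (fun i j k l p q => (r i j p q * r k l p q + 2 * r i p k q * r j p l q
         - 2 * r i p l q * r j p k q) * X i j * (X k l)^*).
  rewrite /tform /S; do 4!(apply: eq_bigr => ? _).
  by rewrite -mulrA mulr_suml; apply: eq_bigr => ? _; rewrite mulr_suml;
    apply: eq_bigr => ? _; rewrite mulrA.
have E1 : \sum_p \sum_q `|\sum_i \sum_j r i j p q * X i j| ^+ 2
  = S (fun p q i j k l => r i j p q * X i j * (r k l p q * (X k l)^*)).
  rewrite /S; apply: eq_bigr => p _; apply: eq_bigr => q _.
  rewrite normCK mulr_suml; apply: eq_bigr => i _.
  rewrite mulr_suml; apply: eq_bigr => j _; rewrite rmorph_sum mulr_sumr.
  apply: eq_bigr => k _; rewrite rmorph_sum mulr_sumr; apply: eq_bigr => l _.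
  by rewrite rmorphM /= rR.
have E2 : \sum_u \sum_v r u.1 u.2 v.1 v.2
        * tform r (ad (delta_mx u.1 u.2) X) (ad (delta_mx v.1 v.2) X)
  = S (fun p q s t a b => r p q s t * (X q a * (X t b)^* * r p a s b))
  + S (fun p q s t a b => r p q s t * - (X q a * (X b s)^* * r p a b t))
  + S (fun p q s t a b => r p q s t * - (X a p * (X t b)^* * r a q s b))
  + S (fun p q s t a b => r p q s t * (X a p * (X b s)^* * r a q b t)).
  rewrite !SD -(pair_bigA _ (fun p q => \sum_v r p q v.1 v.2
        * tform r (ad (delta_mx p q) X) (ad (delta_mx v.1 v.2) X))) /=.
  apply: eq_bigr => p _; apply: eq_bigr => q _.
  rewrite -(pair_bigA _ (fun s t => r p q s t
        * tform r (ad (delta_mx p q) X) (ad (delta_mx s t) X))) /=.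
  apply: eq_bigr => s _; apply: eq_bigr => t _.
  rewrite tform_ad_delta mulr_sumr; apply: eq_bigr => a _.
  by rewrite mulr_sumr; apply: eq_bigr => b _; rewrite /=; ring.
pose un (F : 'I_n -> 'I_n -> 'I_n -> 'I_n -> 'I_n -> 'I_n -> C) (z : T6) :=
  let: (a, b, c, d, e, f) := z in F a b c d e f.
have perm (s t : T6 -> T6) F : cancel s t -> cancel t s ->
    S F = S (fun a b c d e f => un F (s (a, b, c, d, e, f))).
  exact: (@sum6_reindex s t (un F)).
rewrite QE E1 E2.
(* Each permutation renames the indices so that [X] carries (i, j) and its conjugate (k, l). The
   four products of the bracket term then agree two by two, which accounts for the factors 2 in
   [Qtensor]. *)
rewrite [S (fun p q i j k l => _ * X i j * _)](@perm
  (fun '(i, j, k, l, p, q) => (p, q, i, j, k, l))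
  (fun '(p, q, i, j, k, l) => (i, j, k, l, p, q))); try by case=> [[[[[? ?] ?] ?] ?] ?].
rewrite [S (fun p q s t a b => _ * (X q a * (X t b)^* * _))](@perm
  (fun '(i, j, k, l, p, q) => (p, i, q, k, j, l))
  (fun '(p, i, q, k, j, l) => (i, j, k, l, p, q))); try by case=> [[[[[? ?] ?] ?] ?] ?].
rewrite [S (fun p q s t a b => _ * - (X q a * (X b s)^* * _))](@perm
  (fun '(i, j, k, l, p, q) => (p, i, l, q, j, k))
  (fun '(p, i, l, q, j, k) => (i, j, k, l, p, q))); try by case=> [[[[[? ?] ?] ?] ?] ?].
rewrite [S (fun p q s t a b => _ * - (X a p * (X t b)^* * _))](@perm
  (fun '(i, j, k, l, p, q) => (j, p, q, k, i, l))
  (fun '(j, p, q, k, i, l) => (i, j, k, l, p, q))); try by case=> [[[[[? ?] ?] ?] ?] ?].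
rewrite [S (fun p q s t a b => _ * (X a p * (X b s)^* * _))](@perm
  (fun '(i, j, k, l, p, q) => (j, p, l, q, i, k))
  (fun '(j, p, l, q, i, k) => (i, j, k, l, p, q))); try by case=> [[[[[? ?] ?] ?] ?] ?].
rewrite !SD; apply: eqS => i j k l p q /=.
have e1 : r p i q k * r p j q l = r i p k q * r j p l q.
  by rewrite r1 r2 opprK (r1 j p) (r2 j p) opprK.
have e2 : r p i l q * r p j k q = r i p l q * r j p k q.
  by rewrite (r1 i p) (r1 j p) mulrNN.
have e3 : r j p q k * r i p q l = r i p l q * r j p k q.
  by rewrite (r2 j p k q) (r2 i p l q) mulrNN mulrC.
transitivity ((r i j p q * r k l p q + 2 * (r i p k q * r j p l q)
     - 2 * (r i p l q * r j p k q)) * X i j * (X k l)^*); first by ring.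
transitivity ((r i j p q * r k l p q + (r p i q k * r p j q l + r i p k q * r j p l q)
     - (r p i l q * r p j k q + r j p q k * r i p q l)) * X i j * (X k l)^*).
  by rewrite e1 e2 e3; ring.
by ring.
Qed.

Theorem Qtensor_ge0 r x y : curvature_symmetries r ->
  (forall i j k l, (r i j k l)^* = r i j k l) -> gram2_nonneg r ->
  tform r (x^T *m y) (x^T *m y) + `|gram2 x y| = 0 ->
  0 <= tform (Qtensor r) (x^T *m y) (x^T *m y).
Proof.
move=> sr rR rge0 req0; rewrite tform_Qtensor //; apply: addr_ge0.
  by apply: sumr_ge0 => p _; apply: sumr_ge0 => q _; rewrite exprn_ge0.
have h A : A^T = - A -> 0 <= tform r (ad A (x^T *m y)) (ad A (x^T *m y)).
  by move=> sA; exact: second_variation.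
have := sum_ad_wedge_ge0 sr rR h.
by rewrite sum_ad_wedge_delta // pmulr_rge0 // ltr0n.
Qed.

End QForm.

(** * Curvature forms and their complexification *)

Section Complexification.
Variable K : realType.
Local Notation C := K[i].

Definition cvec n (a b : 'rV[K]_n) : 'rV[C]_n := \row_i Complex (a 0 i) (b 0 i).

Lemma cvec_surj n (x : 'rV[C]_n) : exists a b, x = cvec a b.
Proof.
exists (\row_i complex.Re (x 0 i)), (\row_i complex.Im (x 0 i)).
by apply/rowP => i; rewrite !mxE; case: (x 0 i).
Qed.

Lemma conjCE (z : C) : z^* = conjc z.
Proof. by []. Qed.

Lemma sum_Complex (I : Type) (s : seq I) (F G : I -> K) :
  \sum_(i <- s) (Complex (F i) (G i) : C)
  = Complex (\sum_(i <- s) F i) (\sum_(i <- s) G i).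
Proof.
by elim/big_ind3: _ => [|? ? ? ? ? ? -> ->|].
Qed.

Lemma cdot_cvec n (a b c d : 'rV[K]_n) :
  cdot (cvec a b) (cvec c d)
  = Complex (dot a c - dot b d) (dot a d + dot b c).
Proof.
rewrite /cdot mxE /dot -sumrB -big_split /= -sum_Complex.
by apply: eq_bigr => i _; rewrite !mxE.
Qed.

Definition tensorC n (r : tensor4 K n) : tensor4 C n :=
  fun i j k l => (r i j k l)%:C%C.

Lemma tensorC_conj n (r : tensor4 K n) i j k l :
  (tensorC r i j k l)^* = tensorC r i j k l.
Proof. by rewrite conjCE /tensorC /= oppr0. Qed.

Lemma tensorC_sym n (r : tensor4 K n) :
  curvature_symmetries r -> curvature_symmetries (tensorC r).
Proof.
case=> r1 r2 r3; split=> i j k l; rewrite /tensorC.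
- by rewrite r1 rmorphN.
- by rewrite r2 rmorphN.
- by rewrite r3.
Qed.

Definition sum4 n (r : tensor4 K n) (x y z w : 'rV[K]_n) : K :=
  \sum_i \sum_j \sum_k \sum_l r i j k l * (x 0 i * y 0 j * z 0 k * w 0 l).

(* The real part of [x_i * y_j * (x_k * y_l)^*] for [x = a + i b] and
   [y = c + i d]. *)
Definition weight n (a b c d : 'rV[K]_n) (i j k l : 'I_n) : K :=
  (a 0 i * a 0 k + b 0 i * b 0 k) * (c 0 j * c 0 l + d 0 j * d 0 l)
  - (b 0 i * a 0 k - a 0 i * b 0 k) * (d 0 j * c 0 l - c 0 j * d 0 l).

(** The value of [tform] on a decomposable bivector as a real number, linear in [r] with explicit
    weights: the version to be differentiated in time and estimated entrywise. *)
Definition isoform n (r : tensor4 K n) (a b c d : 'rV[K]_n) : K :=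
  \sum_i \sum_j \sum_k \sum_l r i j k l * weight a b c d i j k l.

Lemma tform_cvec n (r : tensor4 K n) (a b c d : 'rV[K]_n) :
  curvature_symmetries r ->
  tform (tensorC r) ((cvec a b)^T *m cvec c d) ((cvec a b)^T *m cvec c d)
  = (isoform r a b c d)%:C%C.
Proof.
move=> sr; have := tform_conj ((cvec a b)^T *m cvec c d)
  ((cvec a b)^T *m cvec c d) (tensorC_sym sr) (tensorC_conj r).
set t := tform _ _ _; case E : t => [u v]; rewrite conjCE /= => -[vN].
have -> : v = 0 by lra.
congr Complex; move: E => /(congr1 (@complex.Re K)) /= <-.
rewrite /t /tform.
have ReS (F : 'I_n -> C) : complex.Re (\sum_i F i) = \sum_i complex.Re (F i).
  by apply: (big_morph (@complex.Re K)) => [[? ?] [? ?]|].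
rewrite ReS; apply: eq_bigr => i _; rewrite ReS; apply: eq_bigr => j _.
rewrite ReS; apply: eq_bigr => k _; rewrite ReS; apply: eq_bigr => l _.
by rewrite conjCE !mxE !big_ord1 !mxE /weight /=; ring.
Qed.

Section Forms.
Variable n : nat.
Implicit Types (R : form4 'rV[K]_n) (x y z w a b c d : 'rV[K]_n).

Definition components R : tensor4 K n := fun i j k l =>
  R (basis_vec i) (basis_vec j) (basis_vec k) (basis_vec l).

Lemma scalar_basis (f : 'rV[K]_n -> K) x : scalar f ->
  f x = \sum_i x 0 i * f (basis_vec i).
Proof.
move=> lf; have f0 : f 0 = 0.
  by have := lf (- 1) 0 0; rewrite scaler0 addr0 mulN1r addNr.
rewrite {1}(row_sum_delta x).
have fD u v : f (u + v) = f u + f v by have := lf 1 u v; rewrite scale1r mul1r.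
rewrite (big_morph f fD f0); apply: eq_bigr => i _.
by rewrite -[_ *: _]addr0 lf f0 addr0.
Qed.

Lemma form4_components R x y z w : four_linear R ->
  R x y z w = sum4 (components R) x y z w.
Proof.
case=> l1 l2 l3 l4; rewrite (scalar_basis x (l1 y z w)); apply: eq_bigr => i _.
rewrite (scalar_basis y (l2 _ z w)) mulr_sumr; apply: eq_bigr => j _.
rewrite (scalar_basis z (l3 _ _ w)) !mulr_sumr; apply: eq_bigr => k _.
rewrite (scalar_basis w (l4 _ _ _)) !mulr_sumr; apply: eq_bigr => l _.
by rewrite /components; ring.
Qed.

Lemma components_sym R : algebraic_curvature_operator R ->
  curvature_symmetries (components R).
Proof. by case=> _ r1 r2 r3 _; split=> i j k l; rewrite /components. Qed.

Definition iso (V : lmodType K) (R : form4 V) (e1 e2 e3 e4 : V) : K :=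
  R e1 e3 e1 e3 + R e1 e4 e1 e4 + R e2 e3 e2 e3 + R e2 e4 e2 e4
  - 2 * R e1 e2 e3 e4.

Lemma isoform_components R a b c d : algebraic_curvature_operator R ->
  isoform (components R) a b c d = iso R a b c d.
Proof.
move=> [l4 r1 r2 r3 r4]; rewrite /iso.
(* The expansion of R(x, y, x^bar, y^bar) yields the four mixed terms on the right; the first
   Bianchi identity merges them into the single term of the isotropic curvature. *)
have -> : - (2 * R a b c d) = R a d b c + R b c a d - R b d a c - R a c b d.
  by rewrite (r3 b c) (r3 b d); have := r4 a b c d; rewrite (r2 a c d b); lra.
rewrite !(form4_components _ _ _ _ l4) /isoform /sum4.
have S4 (F G : tensor4 K n) :
    \sum_i \sum_j \sum_k \sum_l F i j k l + \sum_i \sum_j \sum_k \sum_l G i j k l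
    = \sum_i \sum_j \sum_k \sum_l (F i j k l + G i j k l).
  by do 4!(rewrite -big_split; apply: eq_bigr => ? _).
have N4 (F : tensor4 K n) : - (\sum_i \sum_j \sum_k \sum_l F i j k l)
    = \sum_i \sum_j \sum_k \sum_l - F i j k l.
  by do 4!(rewrite -sumrN; apply: eq_bigr => ? _).
rewrite !N4 !S4; do 4!(apply: eq_bigr => ? _).
by rewrite /weight; ring.
Qed.

End Forms.
End Complexification.

(** * Isotropic planes *)

Section GramSchmidt.
Variables (C : numClosedFieldType) (n : nat).
Implicit Types (r : tensor4 C n) (x y z : 'rV[C]_n) (p q s : C).

Definition hdot x y : C := cdot x (map_mx Num.conj y).

Lemma hdotE x y : hdot x y = \sum_i x 0 i * (y 0 i)^*.
Proof. by rewrite /hdot /cdot mxE; apply: eq_bigr => i _; rewrite !mxE. Qed.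

Lemma hdotDl x y z : hdot (x + y) z = hdot x z + hdot y z.
Proof. by rewrite /hdot /cdot mulmxDl mxE. Qed.

Lemma hdotZl p x y : hdot (p *: x) y = p * hdot x y.
Proof. by rewrite /hdot /cdot -scalemxAl mxE. Qed.

Lemma hdot_conj x y : hdot y x = (hdot x y)^*.
Proof.
rewrite !hdotE rmorph_sum; apply: eq_bigr => i _.
by rewrite rmorphM /= conjCK mulrC.
Qed.

Lemma hdotZr p x y : hdot x (p *: y) = p^* * hdot x y.
Proof. by rewrite hdot_conj hdotZl rmorphM /= -hdot_conj. Qed.

Lemma hdot_ge0 x : 0 <= hdot x x.
Proof. by rewrite hdotE; apply: sumr_ge0 => i _; rewrite mul_conjC_ge0. Qed.

Lemma hdot_eq0 x : (hdot x x == 0) = (x == 0).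
Proof.
apply/idP/eqP => [|->]; last first.
  by rewrite hdotE big1 // => i _; rewrite mxE mul0r.
rewrite hdotE psumr_eq0 => [/allP h|i _]; last by rewrite mul_conjC_ge0.
apply/rowP => i; apply/eqP; rewrite mxE -mul_conjC_eq0.
by apply: h; rewrite mem_index_enum.
Qed.

(** The squared length 2 is that of a + i b with [a], [b] orthonormal, so normalized isotropic pairs
    correspond to orthonormal four-frames. *)
Lemma hdot_normalize x : x != 0 ->
  exists2 p, p != 0 & hdot (p *: x) (p *: x) = 2.
Proof.
move=> x0; have h0 : hdot x x != 0 by rewrite hdot_eq0.
have h_gt0 : 0 < hdot x x by rewrite lt_def h0 hdot_ge0.
exists (sqrtC (2 / hdot x x)).
  by rewrite sqrtC_eq0 mulf_neq0 ?invr_eq0 // pnatr_eq0.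
rewrite hdotZl hdotZr mulrA conj_Creal; last first.
  by rewrite ger0_real // sqrtC_ge0 divr_ge0 // ltW.
by rewrite -expr2 sqrtCK divfK.
Qed.

(** Passing to p x and q (y + s x) only multiplies x /\ y by p q; the first two cases are those
    where x /\ y vanishes. *)
Lemma gram_schmidt x y :
  x = 0 \/ (exists s, y = s *: x) \/
  exists p q s, [/\ p != 0, q != 0, hdot (p *: x) (p *: x) = 2,
    hdot (q *: (y + s *: x)) (q *: (y + s *: x)) = 2
    & hdot (q *: (y + s *: x)) (p *: x) = 0].
Proof.
have [->|x0] := eqVneq x 0; [by left | right].
have h0 : hdot x x != 0 by rewrite hdot_eq0.
pose s := - hdot y x / hdot x x.
have [ys|ys] := eqVneq (y + s *: x) 0.
  by left; exists (- s); rewrite scaleNr; apply/eqP; rewrite -addr_eq0 ys.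
right; have [p p0 hp] := hdot_normalize x0; have [q q0 hq] := hdot_normalize ys.
exists p, q, s; split=> //.
by rewrite hdotZr hdotZl hdotDl hdotZl /s divfK // subrr !mulr0.
Qed.

Lemma cdotZl p x y : cdot (p *: x) y = p * cdot x y.
Proof. by rewrite /cdot -scalemxAl mxE. Qed.

Lemma cdotZr p x y : cdot x (p *: y) = p * cdot x y.
Proof. by rewrite cdotC cdotZl cdotC. Qed.

Lemma cdotDl x y z : cdot (x + y) z = cdot x z + cdot y z.
Proof. by rewrite /cdot mulmxDl mxE. Qed.

Lemma cdotDr x y z : cdot x (y + z) = cdot x y + cdot x z.
Proof. by rewrite cdotC cdotDl !(cdotC x). Qed.

Lemma tform_dyad0 r x Y : curvature_symmetries r -> tform r (x^T *m x) Y = 0.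
Proof.
move=> sr; have := tform_trl (x^T *m x) Y sr.
rewrite trmx_mul trmxK => /eqP; rewrite -addr_eq0 -mulr2n mulrn_eq0.
by move=> /eqP.
Qed.

Lemma tform_dyad0r r x Y : curvature_symmetries r -> tform r Y (x^T *m x) = 0.
Proof.
move=> sr; have := tform_trr Y (x^T *m x) sr.
rewrite trmx_mul trmxK => /eqP; rewrite -addr_eq0 -mulr2n mulrn_eq0.
by move=> /eqP.
Qed.

Lemma tform_shear r p q s x y : curvature_symmetries r ->
  tform r ((p *: x)^T *m (q *: (y + s *: x))) ((p *: x)^T *m (q *: (y + s *: x)))
  = `|p * q| ^+ 2 * tform r (x^T *m y) (x^T *m y).
Proof.
move=> sr; rewrite [(p *: x)^T]linearZ /= -scalemxAl -scalemxAr scalerA.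
rewrite mulmxDr -scalemxAr.
rewrite tformZl tformZr tformDl !tformDr !(tformZl, tformZr).
rewrite !(tform_dyad0, tform_dyad0r) //; rewrite normCK; ring.
Qed.

Lemma gram2_shear p q s x y :
  gram2 (p *: x) (q *: (y + s *: x)) = (p * q) ^+ 2 * gram2 x y.
Proof.
by rewrite /gram2 !(cdotZl, cdotZr, cdotDl, cdotDr) [cdot y x]cdotC; ring.
Qed.

Definition normalized x y := [/\ hdot x x = 2, hdot y y = 2 & hdot y x = 0].

Lemma tform_degenerate r x y : curvature_symmetries r ->
  x = 0 \/ (exists s, y = s *: x) -> tform r (x^T *m y) (x^T *m y) = 0.
Proof.
move=> sr [->|[s ->]]; last by rewrite -scalemxAr tformZl tform_dyad0 // mulr0.
by rewrite trmx0 mul0mx -(scale0r 0) tformZl mul0r.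
Qed.

(** Both terms scale by $|pq|^2$ under the Gram-Schmidt change, so the condition can be tested on
    the compact set of normalized pairs. *)
Lemma gram2_nonneg_normalized r : curvature_symmetries r ->
  (forall x y, normalized x y ->
     0 <= tform r (x^T *m y) (x^T *m y) + `|gram2 x y|) -> gram2_nonneg r.
Proof.
move=> sr H x y.
have [x0|[[s ys]|[p [q [s [p0 q0 h1 h2 h3]]]]]] := gram_schmidt x y.
- by rewrite tform_degenerate ?add0r //; left.
- by rewrite tform_degenerate ?add0r //; right; exists s.
have := H _ _ (And3 h1 h2 h3); rewrite tform_shear // gram2_shear (normrM (_ ^+ 2)).
rewrite normrX -mulrDr pmulr_rge0 // exprn_gt0 // normr_gt0.
exact: mulf_neq0.
Qed.

Lemma isotropic_normalized r : curvature_symmetries r ->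
  (forall x y, normalized x y -> cdot x x = 0 -> cdot x y = 0 -> cdot y y = 0 ->
     0 <= tform r (x^T *m y) (x^T *m y)) ->
  forall x y, cdot x x = 0 -> cdot x y = 0 -> cdot y y = 0 ->
     0 <= tform r (x^T *m y) (x^T *m y).
Proof.
move=> sr H x y xx xy yy.
have [x0|[[s ys]|[p [q [s [p0 q0 h1 h2 h3]]]]]] := gram_schmidt x y.
- by rewrite tform_degenerate //; left.
- by rewrite tform_degenerate //; right; exists s.
have := H _ _ (And3 h1 h2 h3); rewrite tform_shear //.
rewrite !(cdotZl, cdotZr, cdotDl, cdotDr) (cdotC y x) xx xy yy !(mulr0, addr0).
rewrite pmulr_rge0 ?exprn_gt0 ?normr_gt0 ?mulf_neq0 //.
exact.
Qed.

Definition pair2 (F : Type) (a b : F) : 'rV[F]_2 :=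
  \row_(i < 2) if i == 0 then a else b.

Lemma cdot_pair2 (a b c d : C) : cdot (pair2 a b) (pair2 c d) = a * c + b * d.
Proof. by rewrite /cdot mxE !big_ord_recl big_ord0 !mxE /= addr0. Qed.

(** For nonzero [a], complete the square with complex square roots, no positivity being required;
    this is why a plane factor is large enough. *)
Lemma exists_gram (a b c : C) : exists x y : 'rV[C]_2,
  [/\ cdot x x = a, cdot x y = b & cdot y y = c].
Proof.
have key (a' b' c' : C) : a' != 0 -> exists x y : 'rV[C]_2,
    [/\ cdot x x = a', cdot x y = b' & cdot y y = c'].
  move=> a0; have s0 : sqrtC a' != 0 by rewrite sqrtC_eq0.
  exists (pair2 (sqrtC a') 0).
  exists (pair2 (b' / sqrtC a') (sqrtC (c' - (b' / sqrtC a') ^+ 2))).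
  rewrite !cdot_pair2 -!expr2 !sqrtCK expr0n addr0 mul0r addr0; split=> //.
    by rewrite mulrC divfK.
  by rewrite addrC subrK.
have [a0|] := eqVneq a 0; last exact: key.
have [c0|c0] := eqVneq c 0; last first.
  by have [x [y [h1 h2 h3]]] := key c b a c0; exists y, x; rewrite cdotC.
(* With both diagonal entries zero, the two isotropic lines of C^2 are used: (1, i) and (1, -i) have
   product 2. *)
exists (pair2 1 'i), (pair2 (b / 2) (- ('i * (b / 2)))).
have i2 : 'i * 'i = -1 :> C by rewrite -expr2 sqrCi.
rewrite !cdot_pair2 a0 c0; split; first by rewrite i2 mul1r subrr.
  transitivity (b / 2 - 'i * 'i * (b / 2)); first by ring.
  by rewrite i2 mulN1r opprK -splitr.
transitivity ((1 + 'i * 'i) * (b / 2) ^+ 2); first by ring.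
by rewrite i2 subrr mul0r.
Qed.

End GramSchmidt.

(** * Isotropic curvature of the product as a condition on complex bivectors of C^n *)

Section Equivalence.
Variable K : realType.
Local Notation C := K[i].

Lemma dotC n (x y : 'rV[K]_n) : dot x y = dot y x.
Proof. by apply: eq_bigr => i _; rewrite mulrC. Qed.

Lemma dot_scalar n (y : 'rV[K]_n) : scalar (fun x => dot x y).
Proof.
move=> k u v; rewrite /dot /= mulr_sumr -big_split; apply: eq_bigr => i _.
by rewrite /= !mxE; ring.
Qed.

Lemma hdot_cvec n (a b c d : 'rV[K]_n) :
  hdot (cvec a b) (cvec c d)
  = Complex (dot a c + dot b d) (dot b c - dot a d).
Proof.
rewrite hdotE /dot -sumrB -big_split /= -sum_Complex; apply: eq_bigr => i _.
by rewrite !mxE conjCE /=; congr Complex; ring.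
Qed.

Definition sphere_form n : form4 'rV[K]_n :=
  fun x y z w => dot x z * dot y w - dot x w * dot y z.

(** In C^2 the only coordinate of x /\ y is the determinant D of the pair: the left side is $|D|^2$
    and [gram2] is $D^2$. *)
Lemma iso_sphere2 (a b c d : 'rV[K]_2) :
  (iso (@sphere_form 2) a b c d)%:C%C = `|gram2 (cvec a b) (cvec c d)|.
Proof.
have gE (x y : 'rV[C]_2) :
    gram2 x y = (x 0 0 * y 0 1 - x 0 1 * y 0 0) ^+ 2.
  rewrite /gram2 /cdot !mxE !big_ord_recl !big_ord0 !mxE.
  have -> : lift ord0 ord0 = 1 :> 'I_2 by exact: val_inj.
  by ring.
rewrite gE normrX normCK conjCE !mxE /iso /sphere_form /dot.
rewrite !big_ord_recl !big_ord0.
have -> : lift ord0 ord0 = 1 :> 'I_2 by exact: val_inj.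
by apply/eqP; rewrite eq_complex /=; apply/andP; split; apply/eqP; ring.
Qed.

Section Product.
Variables (n : nat) (R : form4 'rV[K]_n).
Hypothesis aR : algebraic_curvature_operator R.

Definition split_vec (x : 'rV[K]_(n + 2)) := (lsubmx x, rsubmx x).

(** The product is flattened to row vectors of length [n + 2] so that the component calculus and the
    complexification above apply to it. *)
Definition joint_form : form4 'rV[K]_(n + 2) := fun x y z w =>
  induced_form R (split_vec x) (split_vec y) (split_vec z) (split_vec w).

Lemma prod_dot_split x y : prod_dot (split_vec x) (split_vec y) = dot x y.
Proof.
rewrite /prod_dot /dot /= big_split_ord /=.
by congr (_ + _); apply: eq_bigr => i _; rewrite !mxE.
Qed.

Lemma joint_form_curvature : algebraic_curvature_operator joint_form.
Proof.
case: aR => -[l1 l2 l3 l4] r1 r2 r3 r4; rewrite /joint_form /induced_form /=.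
have dl k u v (y : 'rV[K]_2) : dot (k *: u + v) y = k * dot u y + dot v y.
  exact: dot_scalar.
have dr k u v (y : 'rV[K]_2) : dot y (k *: u + v) = k * dot y u + dot y v.
  by rewrite dotC dl !(dotC y).
split; first split.
- by move=> y z w k u v /=; rewrite !linearP /= l1 !dl; ring.
- by move=> x z w k u v /=; rewrite !linearP /= l2 !dl; ring.
- by move=> x y w k u v /=; rewrite !linearP /= l3 !dr; ring.
- by move=> x y z k u v /=; rewrite !linearP /= l4 !dr; ring.
- by move=> x y z w; rewrite r1; ring.
- by move=> x y z w; rewrite r2; ring.
- move=> x y z w; rewrite r3 (dotC (rsubmx x) (rsubmx z)).
  rewrite (dotC (rsubmx y) (rsubmx w)) (dotC (rsubmx x) (rsubmx w)).
  by rewrite (dotC (rsubmx y) (rsubmx z)); ring.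
- move=> x y z w; have := r4 (lsubmx x) (lsubmx y) (lsubmx z) (lsubmx w).
  rewrite (dotC (rsubmx w) (rsubmx z)) (dotC (rsubmx w) (rsubmx y)).
  rewrite (dotC (rsubmx z) (rsubmx y)).
  by move=> h; rewrite -[RHS]h; ring.
Qed.

Lemma iso_induced (e1 e2 e3 e4 : 'rV[K]_n * 'rV[K]_2) :
  iso (induced_form R) e1 e2 e3 e4
  = iso R e1.1 e2.1 e3.1 e4.1 + iso (@sphere_form 2) e1.2 e2.2 e3.2 e4.2.
Proof. by rewrite /iso /induced_form /sphere_form; ring. Qed.

Lemma frameP (V : lmodType K) (ip : V -> V -> K) (a b c d : V) :
  (forall x y, ip x y = ip y x) ->
  orthonormal_frame ip [:: a; b; c; d] <->
  [/\ [/\ ip a a = 1, ip b b = 1, ip c c = 1 & ip d d = 1],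
      [/\ ip a b = 0, ip a c = 0 & ip a d = 0]
    & [/\ ip b c = 0, ip b d = 0 & ip c d = 0]].
Proof.
move=> ipC; split=> [h|[[aa bb cc dd] [ab ac ad] [bc bd cd]]].
  by split; split; [exact: (h 0 0)|exact: (h 1 1)|exact: (h 2 2)|exact: (h 3 3)
    |exact: (h 0 1)|exact: (h 0 2)|exact: (h 0 3)
    |exact: (h 1 2)|exact: (h 1 3)|exact: (h 2 3)].
move=> [|[|[|[|i]]]] [|[|[|[|j]]]] //= _ _; rewrite ?eqxx //.
all: by rewrite ipC.
Qed.

Lemma tform_curvature m (S : form4 'rV[K]_m) (a b c d : 'rV[K]_m) :
  algebraic_curvature_operator S ->
  tform (tensorC (components S)) ((cvec a b)^T *m cvec c d)
    ((cvec a b)^T *m cvec c d) = (iso S a b c d)%:C%C.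
Proof.
by move=> aS; rewrite tform_cvec ?isoform_components //; exact: components_sym.
Qed.

(** The real and imaginary parts of the isotropy and normalization equations for a + i b, c + i d
    are exactly the orthonormality relations of [a], [b], [c], [d]. *)
Lemma isotropic_of_nic :
  nonneg_isotropic_curvature (@prod_dot K n 2) (induced_form R) ->
  forall x y : 'rV[C]_(n + 2), cdot x x = 0 -> cdot x y = 0 -> cdot y y = 0 ->
  0 <= tform (tensorC (components joint_form)) (x^T *m y) (x^T *m y).
Proof.
move=> nic; apply: isotropic_normalized.
  by apply/tensorC_sym/components_sym/joint_form_curvature.
move=> x y; have [a [b ->]] := cvec_surj x; have [c [d ->]] := cvec_surj y.
rewrite /normalized !cdot_cvec !hdot_cvec (dotC b a) (dotC d c).
rewrite (dotC c a) (dotC d b) (dotC d a) (dotC c b).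
move=> [[h1 _] [h2 _] [h3 h4]] [h5 h6] [h7 h8] [h9 h10].
rewrite tform_curvature; last exact: joint_form_curvature.
rewrite ler0c; apply: (nic (split_vec a) (split_vec b) (split_vec c) (split_vec d)).
have two : complex.Re (2 : C) = 2 by [].
apply/frameP => [u v|]; first by rewrite /prod_dot dotC (dotC v.2).
rewrite !prod_dot_split; split; split; lra.
Qed.

(** Choose x', y' in C^2 whose Gram matrix is the negative of that of x, y: then (x, x') and (y, y')
    span an isotropic plane, and [gram2], being quadratic in the Gram matrix, has the same value on
    both pairs. *)
Lemma gram2_nonneg_of_nic :
  nonneg_isotropic_curvature (@prod_dot K n 2) (induced_form R) ->
  gram2_nonneg (tensorC (components R)).
Proof.
move=> nic x y.
have [x' [y' [xx xy yy]]] := exists_gram (- cdot x x) (- cdot x y) (- cdot y y).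
have gE : gram2 x y = gram2 x' y' by rewrite /gram2 xx xy yy; ring.
rewrite gE; move: xx xy yy {gE}.
have [a [b ->]] := cvec_surj x; have [c [d ->]] := cvec_surj y.
have [a' [b' ->]] := cvec_surj x'; have [c' [d' ->]] := cvec_surj y'.
move=> xx xy yy; rewrite -iso_sphere2 tform_curvature // -rmorphD /=.
have joinE m (u1 v1 : 'rV[K]_n) (u2 v2 : 'rV[K]_m) :
    cvec (row_mx u1 u2) (row_mx v1 v2) = row_mx (cvec u1 v1) (cvec u2 v2).
  by apply/rowP => i; rewrite !mxE; case: (fintype.split i) => j; rewrite !mxE.
have cdotE m (u1 v1 : 'rV[C]_n) (u2 v2 : 'rV[C]_m) :
    cdot (row_mx u1 u2) (row_mx v1 v2) = cdot u1 v1 + cdot u2 v2.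
  by rewrite /cdot tr_row_mx mul_row_col mxE.
have := isotropic_of_nic nic (x := cvec (row_mx a a') (row_mx b b'))
  (y := cvec (row_mx c c') (row_mx d d')).
rewrite !joinE !cdotE xx xy yy !subrr -!joinE => /(_ erefl erefl erefl).
rewrite tform_curvature; last exact: joint_form_curvature.
by rewrite /joint_form [iso _ _ _ _ _]iso_induced /= !(row_mxKl, row_mxKr).
Qed.

(** An orthonormal frame gives isotropic vectors e1 + i e2 and e3 + i e4, so the Gram matrices of
    their two components are opposite and have equal [gram2]. *)
Lemma nic_of_gram2_nonneg : gram2_nonneg (tensorC (components R)) ->
  nonneg_isotropic_curvature (@prod_dot K n 2) (induced_form R).
Proof.
move=> h e1 e2 e3 e4 /frameP [u v|].
  by rewrite /prod_dot dotC (dotC v.2).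
rewrite /prod_dot => -[[h11 h22 h33 h44] [h12 h13 h14] [h23 h24 h34]].
rewrite -/(iso (induced_form R) e1 e2 e3 e4) iso_induced -ler0c rmorphD /=.
rewrite iso_sphere2 -(tform_curvature e1.1 e2.1 e3.1 e4.1 aR).
have -> : gram2 (cvec e1.2 e2.2) (cvec e3.2 e4.2)
    = gram2 (cvec e1.1 e2.1) (cvec e3.1 e4.1).
  rewrite /gram2.
  have cdotN (a b c d : 'rV[K]_n * 'rV[K]_2) :
      dot a.1 c.1 + dot a.2 c.2 = dot b.1 d.1 + dot b.2 d.2 ->
      dot a.1 d.1 + dot a.2 d.2 = 0 -> dot b.1 c.1 + dot b.2 c.2 = 0 ->
      cdot (cvec a.2 b.2) (cvec c.2 d.2) = - cdot (cvec a.1 b.1) (cvec c.1 d.1).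
    move=> k1 k2 k3; rewrite !cdot_cvec; apply/eqP; rewrite eq_complex /=.
    by apply/andP; split; apply/eqP; lra.
  have h21 : dot e2.1 e1.1 + dot e2.2 e1.2 = 0 by rewrite dotC (dotC e2.2).
  have h43 : dot e4.1 e3.1 + dot e4.2 e3.2 = 0 by rewrite dotC (dotC e4.2).
  rewrite !cdotN; first (by ring); rewrite ?h11 ?h22 ?h33 ?h44 ?h13 ?h24 //.
exact: h.
Qed.

End Product.
End Equivalence.

(** * Perturbation by the curvature tensor of the sphere *)

Section Perturbation.
Variables (K : realType) (n : nat).
Local Notation C := K[i].
Implicit Types (r : tensor4 K n) (a b c d : 'rV[K]_n) (e B : K).

Lemma sphere_form_curvature : algebraic_curvature_operator (@sphere_form K n).
Proof.
have dl k (u v y : 'rV[K]_n) : dot (k *: u + v) y = k * dot u y + dot v y.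
  exact: dot_scalar.
have dr k (u v y : 'rV[K]_n) : dot y (k *: u + v) = k * dot y u + dot y v.
  by rewrite dotC dl !(dotC y).
rewrite /sphere_form; split; first split.
- by move=> y z w k u v /=; rewrite !dl; ring.
- by move=> x z w k u v /=; rewrite !dl; ring.
- by move=> x y w k u v /=; rewrite !dr; ring.
- by move=> x y z k u v /=; rewrite !dr; ring.
- by move=> x y z w; ring.
- by move=> x y z w; ring.
- by move=> x y z w; rewrite (dotC x z) (dotC y w) (dotC x w) (dotC y z); ring.
- by move=> x y z w; rewrite (dotC w z) (dotC w y) (dotC z y); ring.
Qed.

Definition sphere_tensor : tensor4 K n := components (@sphere_form K n).

Lemma dot_basis (i j : 'I_n) : dot (basis_vec i) (basis_vec j) = (i == j)%:R :> K.
Proof.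
rewrite /dot (bigD1 i) //= big1 ?addr0 => [|k ki]; last first.
  by rewrite !mxE (negPf ki) mul0r.
by rewrite !mxE !eqxx mul1r.
Qed.

Lemma sphere_tensor_le1 i j k l : `|sphere_tensor i j k l| <= 1.
Proof.
rewrite /sphere_tensor /components /sphere_form !dot_basis -!natrM !mulnb.
by do 2!case: (_ && _); rewrite ?subrr ?subr0 ?sub0r ?normrN ?normr0 ?normr1 ?ler01.
Qed.

Definition perturb r e : tensor4 K n :=
  fun i j k l => r i j k l + e * sphere_tensor i j k l.

Lemma perturb_sym r e : curvature_symmetries r -> curvature_symmetries (perturb r e).
Proof.
case=> r1 r2 r3; have [s1 s2 s3] := components_sym sphere_form_curvature.
split=> i j k l; rewrite /perturb /sphere_tensor.
- by rewrite r1 s1; ring.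
- by rewrite r2 s2; ring.
- by rewrite r3 s3.
Qed.

Lemma isoformD r r' a b c d :
  isoform (fun i j k l => r i j k l + r' i j k l) a b c d
  = isoform r a b c d + isoform r' a b c d.
Proof.
by rewrite /isoform; do 4!(rewrite -big_split; apply: eq_bigr => ? _); rewrite mulrDl.
Qed.

Lemma isoformZ r e a b c d :
  isoform (fun i j k l => e * r i j k l) a b c d = e * isoform r a b c d.
Proof.
by rewrite /isoform; do 4!(rewrite mulr_sumr; apply: eq_bigr => ? _); rewrite mulrA.
Qed.

Lemma normalized_cvec a b c d : normalized (cvec a b) (cvec c d) <->
  [/\ dot a a + dot b b = 2, dot c c + dot d d = 2,
      dot a c + dot b d = 0 & dot a d - dot b c = 0].
Proof.
rewrite /normalized !hdot_cvec (dotC b a) (dotC d c).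
rewrite (dotC c a) (dotC d b) (dotC d a) (dotC c b).
split=> [[[h1 _] [h2 _] [h3 h4]]|[-> -> -> ->]]; last first.
  by rewrite !subrr; split=> //; apply/eqP; rewrite eq_complex /= addr0 !eqxx.
by split.
Qed.

(** On the sphere tensor [isoform] is the Hermitian Gram determinant of x, y, here 2 * 2 - 0. *)
Lemma isoform_sphere a b c d : normalized (cvec a b) (cvec c d) ->
  isoform sphere_tensor a b c d = 4.
Proof.
move=> /normalized_cvec [h1 h2 h3 h4].
rewrite isoform_components; last exact: sphere_form_curvature.
rewrite /iso /sphere_form (dotC c a) (dotC d a) (dotC c b) (dotC d b).
transitivity ((dot a a + dot b b) * (dot c c + dot d d)
  - (dot a c + dot b d) ^+ 2 - (dot a d - dot b c) ^+ 2); first by ring.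
by rewrite h1 h2 h3 h4; ring.
Qed.

Lemma isoform_perturb r e a b c d : normalized (cvec a b) (cvec c d) ->
  isoform (perturb r e) a b c d = isoform r a b c d + 4 * e.
Proof.
by move=> h; rewrite /perturb isoformD isoformZ isoform_sphere // mulrC.
Qed.

Lemma entry_le2 a i : dot a a <= 2 -> `|a 0 i| <= 2.
Proof.
rewrite /dot (bigD1 i) //= => h; have : a 0 i * a 0 i <= 2.
  apply: le_trans h; rewrite lerDl; apply: sumr_ge0 => j _.
  by rewrite -expr2 sqr_ge0.
by rewrite ler_norml => h2; apply/andP; split; nra.
Qed.

Lemma dot_ge0 a : 0 <= dot a a.
Proof. by apply: sumr_ge0 => i _; rewrite -expr2 sqr_ge0. Qed.

(** A crude bound: entries are at most 2, products of two at most 4, sums of two such at most 8, and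
    the weight is a difference of two products of these sums. *)
Lemma weight_le a b c d i j k l : normalized (cvec a b) (cvec c d) ->
  `|weight a b c d i j k l| <= 128.
Proof.
move=> /normalized_cvec [h1 h2 _ _].
have ha m : `|a 0 m| <= 2 by apply: entry_le2; have := dot_ge0 b; lra.
have hb m : `|b 0 m| <= 2 by apply: entry_le2; have := dot_ge0 a; lra.
have hc m : `|c 0 m| <= 2 by apply: entry_le2; have := dot_ge0 d; lra.
have hd m : `|d 0 m| <= 2 by apply: entry_le2; have := dot_ge0 c; lra.
have e4 : 4 = 2 * 2 :> K by rewrite -natrM.
have e64 : 64 = 8 * 8 :> K by rewrite -natrM.
have M2 (x y : K) : `|x| <= 2 -> `|y| <= 2 -> `|x * y| <= 4.
  by move=> hx hy; rewrite normrM e4 ler_pM.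
have M4 (x y z w : K) : `|x| <= 4 -> `|y| <= 4 -> `|z| <= 4 -> `|w| <= 4 ->
    `|(x + y) * (z + w)| <= 64.
  move=> hx hy hz hw; rewrite normrM e64 ler_pM //.
    by apply: le_trans (ler_normD _ _) _; lra.
  by apply: le_trans (ler_normD _ _) _; lra.
rewrite /weight; apply: le_trans (ler_normB _ _) _.
have -> : 128 = 64 + 64 :> K by rewrite -natrD.
by apply: lerD; apply: M4; rewrite ?normrN; apply: M2.
Qed.

Lemma isoform_le r a b c d e : normalized (cvec a b) (cvec c d) ->
  (forall i j k l, `|r i j k l| <= e) ->
  `|isoform r a b c d|
    <= e * \sum_(i < n) \sum_(j < n) \sum_(k < n) \sum_(l < n) 128.
Proof.
move=> nm re; rewrite /isoform.
do 4!(rewrite mulr_sumr; apply: le_trans (ler_norm_sum _ _ _) _;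
  apply: ler_sum => ? _).
by rewrite normrM ler_pM // weight_le.
Qed.

(** The coefficients 1, 2, 2 in [Qtensor] add up to 5, and each product of two entries bounded by
    [B] changes by at most e (2 B + 1) when e <= 1. *)
Definition Qlipschitz B : K := \sum_(p < n) \sum_(q < n) 5 * (2 * B + 1).

Lemma Qtensor_perturb_le r e B : 0 <= e <= 1 ->
  (forall i j k l, `|r i j k l| <= B) ->
  forall i j k l, `|Qtensor (perturb r e) i j k l - Qtensor r i j k l|
    <= e * Qlipschitz B.
Proof.
move=> /andP[e0 e1] rB i j k l; rewrite /Qtensor /Qlipschitz mulr_sumr -sumrB.
apply: le_trans (ler_norm_sum _ _ _) _; apply: ler_sum => p _.
rewrite mulr_sumr -sumrB; apply: le_trans (ler_norm_sum _ _ _) _.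
apply: ler_sum => q _; rewrite /perturb.
have key x y u v : `|x| <= B -> `|y| <= B -> `|u| <= 1 -> `|v| <= 1 ->
    `|(x + e * u) * (y + e * v) - x * y| <= e * (2 * B + 1).
  move=> hx hy hu hv.
  have -> : (x + e * u) * (y + e * v) - x * y
    = e * (x * v + u * y + e * (u * v)) by ring.
  rewrite normrM ger0_norm // ler_wpM2l //.
  apply: le_trans (ler_normD _ _) _; apply: lerD.
    apply: le_trans (ler_normD _ _) _.
    rewrite (_ : 2 * B = B * 1 + 1 * B); last by ring.
    by apply: lerD; rewrite normrM ler_pM.
  rewrite -[leRHS](mulr1 1) normrM ler_pM // ?(ger0_norm e0) //.
  by rewrite normrM -[leRHS](mulr1 1) ler_pM.
have := key _ _ _ _ (rB i j p q) (rB k l p q)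
  (sphere_tensor_le1 i j p q) (sphere_tensor_le1 k l p q).
have := key _ _ _ _ (rB i p k q) (rB j p l q)
  (sphere_tensor_le1 i p k q) (sphere_tensor_le1 j p l q).
have := key _ _ _ _ (rB i p l q) (rB j p k q)
  (sphere_tensor_le1 i p l q) (sphere_tensor_le1 j p k q).
rewrite !ler_norml => /andP[k1 k2] /andP[k3 k4] /andP[k5 k6].
by apply/andP; split; lra.
Qed.

End Perturbation.

(** * The curvature condition as a family of real functions *)

Section Gap.
Variables (K : realType) (n : nat).
Implicit Types (r : tensor4 K n) (a b c d : 'rV[K]_n).

Definition gap r a b c d : K :=
  isoform r a b c d + Normc.normc (gram2 (cvec a b) (cvec c d)).

Lemma gapE r a b c d : curvature_symmetries r ->
  tform (tensorC r) ((cvec a b)^T *m cvec c d) ((cvec a b)^T *m cvec c d)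
    + `|gram2 (cvec a b) (cvec c d)| = (gap r a b c d)%:C%C.
Proof. by move=> sr; rewrite tform_cvec // /gap rmorphD. Qed.

Lemma gram2_nonneg_gap r : curvature_symmetries r ->
  (forall a b c d, normalized (cvec a b) (cvec c d) -> 0 <= gap r a b c d) ->
  gram2_nonneg (tensorC r).
Proof.
move=> sr H; apply: gram2_nonneg_normalized; first exact: tensorC_sym.
move=> x y; have [a [b ->]] := cvec_surj x; have [c [d ->]] := cvec_surj y.
by move=> nm; rewrite gapE // ler0c; apply: H.
Qed.

Lemma gap_gram2_nonneg r a b c d : curvature_symmetries r ->
  gram2_nonneg (tensorC r) -> 0 <= gap r a b c d.
Proof. by move=> sr /(_ (cvec a b) (cvec c d)); rewrite gapE // ler0c. Qed.

Lemma isoform_Qtensor_ge0 r a b c d : curvature_symmetries r ->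
  gram2_nonneg (tensorC r) -> gap r a b c d = 0 ->
  0 <= isoform (Qtensor r) a b c d.
Proof.
move=> sr h g0.
have QC : tform (Qtensor (tensorC r)) ((cvec a b)^T *m cvec c d)
      ((cvec a b)^T *m cvec c d) = (isoform (Qtensor r) a b c d)%:C%C.
  have sQ : curvature_symmetries (Qtensor r).
    case: sr => r1 r2 r3; split=> i j k l; rewrite /Qtensor.
    - rewrite -sumrN; apply: eq_bigr => p _; rewrite -sumrN; apply: eq_bigr => q _.
      by rewrite (r1 i j); ring.
    - rewrite -sumrN; apply: eq_bigr => p _; rewrite -sumrN; apply: eq_bigr => q _.
      by rewrite (r1 k l); ring.
    - have tot (F G H : 'I_n -> 'I_n -> K) :
          \sum_p \sum_q (F p q + 2 * G p q - 2 * H p q)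
          = \sum_p \sum_q F p q + 2 * (\sum_p \sum_q G p q)
            - 2 * (\sum_p \sum_q H p q).
        rewrite !mulr_sumr -sumrN -!big_split; apply: eq_bigr => p _ /=.
        by rewrite !mulr_sumr -sumrN -!big_split.
      under eq_bigr do under eq_bigr do rewrite -!mulrA.
      under [in RHS]eq_bigr do under eq_bigr do rewrite -!mulrA.
      rewrite !tot; congr (_ + _ - 2 * _).
      + by apply: eq_bigr => p _; apply: eq_bigr => q _; rewrite mulrC.
      + congr (2 * _); rewrite exchange_big; apply: eq_bigr => p _.
        by apply: eq_bigr => q _; rewrite (r3 i p) (r3 j p).
      + rewrite exchange_big; apply: eq_bigr => p _.
        by apply: eq_bigr => q _; rewrite (r3 j p) (r3 i p) mulrC.
  rewrite -tform_cvec //; congr (tform _ _ _).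
  apply/funext => i; apply/funext => j; apply/funext => k; apply/funext => l.
  rewrite /Qtensor /tensorC rmorph_sum; apply: eq_bigr => p _.
  rewrite rmorph_sum; apply: eq_bigr => q _.
  by rewrite rmorphB rmorphD /= !rmorphM /= rmorph_nat.
rewrite -ler0c -QC; apply: Qtensor_ge0 => //.
- exact: tensorC_sym.
- exact: tensorC_conj.
- by rewrite gapE // g0.
Qed.

Lemma gap_perturb r e a b c d : normalized (cvec a b) (cvec c d) ->
  gap (perturb r e) a b c d = gap r a b c d + 4 * e.
Proof. by move=> nm; rewrite /gap isoform_perturb //; ring. Qed.

End Gap.

Section Continuity.
Variables (K : realType) (n : nat) (X : topologicalType).
Implicit Types (u v w t : X -> 'rV[K]_n) (f g : X -> K).

Lemma continuous_coord u i : continuous u -> continuous (fun z => u z 0 i).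
Proof.
move=> cu z; apply: (@continuous_comp _ _ _ u (fun y : 'rV[K]_n => y 0 i)).
  exact: cu.
exact: coord_continuous.
Qed.

Lemma continuous_mul f g :
  continuous f -> continuous g -> continuous (fun z => f z * g z).
Proof. by move=> cf cg z; apply: continuousM; [exact: cf|exact: cg]. Qed.

Lemma continuous_add f g :
  continuous f -> continuous g -> continuous (fun z => f z + g z).
Proof. by move=> cf cg z; apply: continuousD; [exact: cf|exact: cg]. Qed.

Lemma continuous_opp f : continuous f -> continuous (fun z => - f z).
Proof. by move=> cf z; apply: continuousN; exact: cf. Qed.

Lemma continuous_sub f g :
  continuous f -> continuous g -> continuous (fun z => f z - g z).
Proof. by move=> cf cg; apply: continuous_add => //; exact: continuous_opp. Qed.

Lemma continuous_sum (I : finType) (F : I -> X -> K) :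
  (forall i, continuous (F i)) -> continuous (fun z => \sum_i F i z).
Proof.
by move=> cF; apply: continuous_big => [|i _]; [exact: add_continuous | exact: cF].
Qed.

Lemma continuous_dot u v :
  continuous u -> continuous v -> continuous (fun z => dot (u z) (v z)).
Proof.
move=> cu cv; apply: continuous_sum => i.
by apply: continuous_mul; exact: continuous_coord.
Qed.

Lemma continuous_normc_gram2 u v w t :
  continuous u -> continuous v -> continuous w -> continuous t ->
  continuous (fun z => Normc.normc (gram2 (cvec (u z) (v z)) (cvec (w z) (t z)))).
Proof.
move=> cu cv cw ct.
have [P [EP cP]] : exists P : X -> K,
    (fun z => Normc.normc (gram2 (cvec (u z) (v z)) (cvec (w z) (t z))))
      = @Num.sqrt K \o P /\ continuous P.
  (* The six functions stand for the real and imaginary parts of [cdot x x], [cdot y y] and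
     [cdot x y], in this order; the sum is the squared modulus of [gram2]. *)
  have poly (f1 f2 f3 f4 f5 f6 : X -> K) : continuous f1 -> continuous f2 ->
      continuous f3 -> continuous f4 -> continuous f5 -> continuous f6 ->
      continuous (fun z => (f1 z * f3 z - f2 z * f4 z - (f5 z * f5 z - f6 z * f6 z)) ^+ 2
        + (f1 z * f4 z + f2 z * f3 z - (f5 z * f6 z + f6 z * f5 z)) ^+ 2).
    move=> c1 c2 c3 c4 c5 c6.
    have c7 := continuous_sub
      (continuous_sub (continuous_mul c1 c3) (continuous_mul c2 c4))
      (continuous_sub (continuous_mul c5 c5) (continuous_mul c6 c6)).
    have c8 := continuous_sub
      (continuous_add (continuous_mul c1 c4) (continuous_mul c2 c3))
      (continuous_add (continuous_mul c5 c6) (continuous_mul c6 c5)).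
    exact: continuous_add (continuous_mul c7 c7) (continuous_mul c8 c8).
  have re (x y x' y' : X -> 'rV[K]_n) : continuous x -> continuous y ->
      continuous x' -> continuous y' ->
      continuous (fun z => dot (x z) (y z) + dot (x' z) (y' z)).
    by move=> *; apply: continuous_add; exact: continuous_dot.
  have im (x y x' y' : X -> 'rV[K]_n) : continuous x -> continuous y ->
      continuous x' -> continuous y' ->
      continuous (fun z => dot (x z) (y z) - dot (x' z) (y' z)).
    by move=> *; apply: continuous_sub; exact: continuous_dot.
  eexists; split; last first.
    exact: (poly _ _ _ _ _ _ (im _ _ _ _ cu cu cv cv) (re _ _ _ _ cu cv cv cu)
      (im _ _ _ _ cw cw ct ct) (re _ _ _ _ cw ct ct cw)
      (im _ _ _ _ cu cw cv ct) (re _ _ _ _ cu ct cv cw)).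
  by apply/funext => z; rewrite /gram2 !cdot_cvec expr2.
by rewrite EP => z; apply: continuous_comp; [exact: cP | exact: sqrt_continuous].
Qed.

Lemma continuous_gap (r : X -> tensor4 K n) u v w t :
  (forall i j k l, continuous (fun z => r z i j k l)) ->
  continuous u -> continuous v -> continuous w -> continuous t ->
  continuous (fun z => gap (r z) (u z) (v z) (w z) (t z)).
Proof.
move=> cr cu cv cw ct; apply: continuous_add; last exact: continuous_normc_gram2.
have poly (f1 f2 f3 f4 f5 f6 f7 f8 : X -> K) : continuous f1 -> continuous f2 ->
    continuous f3 -> continuous f4 -> continuous f5 -> continuous f6 ->
    continuous f7 -> continuous f8 ->
    continuous (fun z => (f1 z * f2 z + f3 z * f4 z) * (f5 z * f6 z + f7 z * f8 z)
      - (f3 z * f2 z - f1 z * f4 z) * (f7 z * f6 z - f5 z * f8 z)).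
  move=> c1 c2 c3 c4 c5 c6 c7 c8.
  exact: continuous_sub
    (continuous_mul
      (continuous_add (continuous_mul c1 c2) (continuous_mul c3 c4))
      (continuous_add (continuous_mul c5 c6) (continuous_mul c7 c8)))
    (continuous_mul
      (continuous_sub (continuous_mul c3 c2) (continuous_mul c1 c4))
      (continuous_sub (continuous_mul c7 c6) (continuous_mul c5 c8))).
do 4!(apply: continuous_sum => ?); apply: continuous_mul => //.
by apply: poly; exact: continuous_coord.
Qed.

End Continuity.

(** * The maximum principle *)

Section OneSidedDerivative.
Variables (K : realType) (D : set K).
Implicit Types (f : K -> K) (s t l e : K).

Lemma has_derivative_withinP f t l : has_derivative_within D f t l ->
  forall e, 0 < e -> exists2 d, 0 < d & forall s, D s -> s != t ->
    `|s - t| < d -> `|(f s - f t) / (s - t) - l| < e.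
Proof.
move=> /cvgrPdist_lt h e e0; have := h e e0.
rewrite near_withinE => /nbhs_ballP[d d0 hd]; exists d => // s Ds st sd.
rewrite distrC; apply: hd => //=.
by rewrite /ball /= distrC.
Qed.

Lemma has_derivative_within_near f t l : has_derivative_within D f t l ->
  forall e, 0 < e -> exists2 d, 0 < d & forall s, D s ->
    `|s - t| < d -> `|f s - f t| < e.
Proof.
move=> /has_derivative_withinP/(_ 1 ltr01)[d d0 hd] e e0.
have l0 : 0 < `|l| + 1 by rewrite ltr_wpDl.
exists (Num.min d (e / (`|l| + 1))); first by rewrite lt_min d0 divr_gt0.
move=> s Ds; rewrite lt_min => /andP[sd se].
have [->|st] := eqVneq s t; first by rewrite subrr normr0.
have q_le : `|(f s - f t) / (s - t)| < `|l| + 1.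
  rewrite -(subrK l ((f s - f t) / (s - t))) addrC.
  by apply: le_lt_trans (ler_normD _ _) _; rewrite ltrD2l hd.
have st0 : s - t != 0 by rewrite subr_eq0.
rewrite -(divfK st0 (f s - f t)) normrM.
apply: lt_le_trans (_ : (`|l| + 1) * `|s - t| <= e).
  by rewrite ltr_pM2r // normr_gt0.
by rewrite mulrC -ler_pdivlMr // ltW.
Qed.

Lemma has_derivative_within_sum (I : finType) (f : I -> K -> K) (l : I -> K) t :
  (forall i, has_derivative_within D (f i) t (l i)) ->
  has_derivative_within D (fun s => \sum_i f i s) t (\sum_i l i).
Proof.
move=> hf; rewrite /has_derivative_within.
under eq_fun do rewrite -sumrB mulr_suml.
by apply: cvg_big => [|i _]; [exact: add_continuous | exact: hf].
Qed.

Lemma has_derivative_withinMr f t l e : has_derivative_within D f t l ->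
  has_derivative_within D (fun s => f s * e) t (l * e).
Proof.
move=> hf; rewrite /has_derivative_within.
under eq_fun do rewrite -mulrBl mulrAC.
by apply: cvgMl; exact: hf.
Qed.

End OneSidedDerivative.

Section Clip.
Variables (K : realType) (T : \bar K).
Implicit Types (f : K -> K) (s t : K).

Lemma time_interval_le s t : 0 <= s -> s <= t -> time_interval T t ->
  time_interval T s.
Proof. by move=> s0 st [_ tT]; split=> //; apply: le_lt_trans tT; rewrite lee_fin. Qed.

(** The retraction of the line onto [0, t1]. Composing with it turns a solution known only on the
    time interval into a function continuous everywhere. *)
Definition clip t1 t := Num.max 0 (Num.min t t1).

Lemma clip_ge0 t1 t : 0 <= clip t1 t.
Proof. by rewrite /clip le_max lexx. Qed.

Lemma clip_le t1 t : 0 <= t1 -> clip t1 t <= t1.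
Proof. by move=> h; rewrite /clip ge_max h ge_min lexx orbT. Qed.

Lemma clip_id t1 t : 0 <= t <= t1 -> clip t1 t = t.
Proof. by move=> /andP[t0 tt1]; rewrite /clip (min_idPl tt1) (max_idPr t0). Qed.

Lemma clip_lipschitz t1 s t : `|clip t1 s - clip t1 t| <= `|s - t|.
Proof.
have := ler_norm (s - t); have := ler_norm (t - s); rewrite (distrC t s) => ? ?.
rewrite /clip; case: (lerP s t1) => ?; case: (lerP t t1) => ?.
all: case: (lerP 0 s) => ?; case: (lerP 0 t) => ?; case: (lerP 0 t1) => ?.
all: rewrite ler_norml; apply/andP; split; lra.
Qed.

Lemma continuous_clip f t1 : 0 <= t1 -> time_interval T t1 ->
  (forall t, time_interval T t -> exists l,
     has_derivative_within (time_interval T) f t l) ->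
  continuous (fun t => f (clip t1 t)).
Proof.
move=> t10 Dt1 hf t.
have Dc s : time_interval T (clip t1 s).
  by apply: time_interval_le Dt1; [exact: clip_ge0 | exact: clip_le].
have [l /has_derivative_within_near h] := hf _ (Dc t).
apply/cvgrPdist_lt => e e0; have [d d0 hd] := h e e0.
apply/nbhs_ballP; exists d => //= s; rewrite /ball /= => ts.
rewrite distrC; apply: hd => //.
by apply: le_lt_trans (clip_lipschitz _ _ _) _; rewrite distrC.
Qed.

End Clip.

Lemma compact_box (K : realType) n (m : K) :
  compact [set v : 'rV[K]_n | forall i, v ord0 i \in `[- m, m]].
Proof. exact: (rV_compact (fun _ => @segment_compact K (- m) m)). Qed.

Section Compactness.
Variables (K : realType) (n : nat) (t1 : K) (g : K -> tensor4 K n).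
Hypothesis cg : forall i j k l, continuous (fun t => g t i j k l).

Lemma closed_nonpositive_gap (X : topologicalType) (tau : X -> K)
    (u v w x : X -> 'rV[K]_n) : continuous tau ->
  continuous u -> continuous v -> continuous w -> continuous x ->
  closed [set z | 0 <= tau z <= t1 /\
    normalized (cvec (u z) (v z)) (cvec (w z) (x z)) /\
    gap (g (tau z)) (u z) (v z) (w z) (x z) <= 0].
Proof.
move=> ctau cu cv cw cx.
have closed_level (f : X -> K) (A : set K) : continuous f -> closed A ->
    closed (f @^-1` A).
  by move=> cf cA; apply: preimage_closed => // z _; exact: cf.
rewrite (_ : mkset _ = tau @^-1` `[0, t1]
  `&` ((fun z => dot (u z) (u z) + dot (v z) (v z)) @^-1` [set 2]
  `&` ((fun z => dot (w z) (w z) + dot (x z) (x z)) @^-1` [set 2]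
  `&` ((fun z => dot (u z) (w z) + dot (v z) (x z)) @^-1` [set 0]
  `&` ((fun z => dot (u z) (x z) - dot (v z) (w z)) @^-1` [set 0]
  `&` ((fun z => gap (g (tau z)) (u z) (v z) (w z) (x z)) @^-1` [set y | y <= 0])))))).
  apply: closedI; first by apply: closed_level => //; exact: interval_closed.
  apply: closedI.
    apply: closed_level; last exact: closed_eq.
    by apply: continuous_add; exact: continuous_dot.
  apply: closedI.
    apply: closed_level; last exact: closed_eq.
    by apply: continuous_add; exact: continuous_dot.
  apply: closedI.
    apply: closed_level; last exact: closed_eq.
    by apply: continuous_add; exact: continuous_dot.
  apply: closedI.
    apply: closed_level; last exact: closed_eq.
    by apply: continuous_sub; exact: continuous_dot.
  apply: closed_level; last exact: closed_le.
  apply: continuous_gap => // i j k l z.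
  by apply: (@continuous_comp _ _ _ tau (fun t => g t i j k l));
    [exact: ctau | exact: cg].
apply/seteqP; split=> z /=; rewrite in_itv /=.
  move=> [h1 [/normalized_cvec[h2 h3 h4 h5] h6]].
  exact: conj h1 (conj h2 (conj h3 (conj h4 (conj h5 h6)))).
move=> [h1 [h2 [h3 [h4 [h5 h6]]]]].
by split=> //; split=> //; apply/normalized_cvec; split.
Qed.

Let W := (K * ('rV[K]_n * 'rV[K]_n) * ('rV[K]_n * 'rV[K]_n))%type.

(** Times in [0, t1] together with normalized pairs of nonpositive gap form a nonempty compact set;
    the time coordinate attains its minimum there. *)
Lemma first_nonpositive_gap (t : K) (a b c d : 'rV[K]_n) : 0 <= t <= t1 ->
  normalized (cvec a b) (cvec c d) -> gap (g t) a b c d <= 0 ->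
  exists s, 0 <= s <= t1 /\
    (exists a b c d, normalized (cvec a b) (cvec c d) /\ gap (g s) a b c d <= 0)
    /\ forall s', 0 <= s' -> s' < s -> forall a b c d,
         normalized (cvec a b) (cvec c d) -> 0 < gap (g s') a b c d.
Proof.
move=> tI nm0 g0.
pose u (z : W) := z.1.2.1; pose v (z : W) := z.1.2.2.
pose w (z : W) := z.2.1; pose x (z : W) := z.2.2.
have ctime : continuous (fun z : W => z.1.1).
  by move=> z; apply: continuous_comp; exact: cvg_fst.
have cu : continuous u.
  move=> z; apply: (@continuous_comp _ _ _ (fun z : W => z.1.2) fst); last exact: cvg_fst.
  by apply: continuous_comp; [exact: cvg_fst | exact: cvg_snd].
have cv : continuous v.
  move=> z; apply: (@continuous_comp _ _ _ (fun z : W => z.1.2) snd); last exact: cvg_snd.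
  by apply: continuous_comp; [exact: cvg_fst | exact: cvg_snd].
have cw : continuous w.
  by move=> z; apply: continuous_comp; [exact: cvg_snd | exact: cvg_fst].
have cx : continuous x.
  by move=> z; apply: continuous_comp; [exact: cvg_snd | exact: cvg_snd].
pose B : set W := [set z | 0 <= z.1.1 <= t1 /\
  normalized (cvec (u z) (v z)) (cvec (w z) (x z)) /\
  gap (g z.1.1) (u z) (v z) (w z) (x z) <= 0].
have Bclosed : closed B := closed_nonpositive_gap ctime cu cv cw cx.
pose box := [set y : 'rV[K]_n | forall i, y ord0 i \in `[- 2, 2]].
have cbox : compact box by exact: compact_box.
have Bcompact : compact B.
  apply: (@subclosed_compact _ B (`[0, t1] `*` (box `*` box) `*` (box `*` box))) => //.
    exact (compact_setX (compact_setX (@segment_compact K 0 t1) (compact_setX cbox cbox))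
      (compact_setX cbox cbox)).
  move=> z [h1 [/normalized_cvec[h2 h3 _ _] _]].
  have hu := dot_ge0 (u z); have hv := dot_ge0 (v z).
  have hw := dot_ge0 (w z); have hx := dot_ge0 (x z).
  have bx (y : 'rV[K]_n) : dot y y <= 2 -> box y.
    by move=> hy i; rewrite /= in_itv /= -ler_norml; exact: entry_le2.
  split; split; rewrite /= ?in_itv //=; try split; apply: bx.
  - by rewrite -/(u z); lra.
  - by rewrite -/(v z); lra.
  - by rewrite -/(w z); lra.
  - by rewrite -/(x z); lra.
have B0 : B !=set0 by exists ((t, (a, b)), (c, d)); split.
have [|z zB zmin] := @compact_EVT_min W K (fun z => z.1.1) B B0 Bcompact.
  exact: continuous_subspaceT.
move: zB; rewrite inE => -[zI [znm zg]].
exists z.1.1; split=> //; split; first by exists (u z), (v z), (w z), (x z).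
move=> s' s'0 s's a' b' c' d' nm'; rewrite ltNge; apply/negP => g'.
have /zmin : ((s', (a', b')), (c', d')) \in B.
  rewrite inE; split=> //=; rewrite s'0 (le_trans (ltW s's)) //.
  by case/andP: zI.
by rewrite leNgt /= s's.
Qed.

End Compactness.

(** * Barrier and first contact along the flow *)

Section Flow.
Variables (K : realType) (n : nat) (T : \bar K) (r : K -> tensor4 K n).
Hypothesis r_sym : forall t, time_interval T t -> curvature_symmetries (r t).
Hypothesis r_flow : forall t, time_interval T t -> forall i j k l,
  has_derivative_within (time_interval T) (fun s => r s i j k l) t
    (Qtensor (r t) i j k l).

Lemma isoform_flow t a b c d : time_interval T t ->
  has_derivative_within (time_interval T) (fun s => isoform (r s) a b c d) t
    (isoform (Qtensor (r t)) a b c d).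
Proof.
move=> Dt; do 4!(apply: has_derivative_within_sum => ?).
by apply: has_derivative_withinMr; exact: r_flow.
Qed.

Lemma continuous_flow_clip t1 : 0 <= t1 -> time_interval T t1 ->
  forall i j k l, continuous (fun t => r (clip t1 t) i j k l).
Proof.
move=> t10 Dt1 i j k l; apply: (@continuous_clip _ T (fun t => r t i j k l)) => //.
by move=> t Dt; eexists; exact: r_flow.
Qed.

Lemma flow_bounded t1 : 0 <= t1 -> time_interval T t1 ->
  exists2 B, 0 <= B & forall t, 0 <= t <= t1 -> forall i j k l, `|r t i j k l| <= B.
Proof.
move=> t10 Dt1; have cr := continuous_flow_clip t10 Dt1.
pose M t := \sum_i \sum_j \sum_k \sum_l `|r (clip t1 t) i j k l|.
have cM : continuous M.
  do 4!(apply: continuous_sum => ?); move=> t.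
  by apply: (@continuous_comp _ _ _ _ (@Num.norm _ K));
    [exact: cr | exact: norm_continuous].
have [t0 _ Mmax] := EVT_max t10 (continuous_subspaceT cM).
have M0 t : 0 <= M t by do 4!(apply: sumr_ge0 => ? _).
exists (M t0) => // t tI i j k l; have : M t <= M t0 by apply: Mmax; rewrite in_itv.
apply: le_trans; rewrite -{1}(clip_id tI) /M.
rewrite (bigD1 i) //= (bigD1 j) //= (bigD1 k) //= (bigD1 l) //=.
rewrite -!addrA lerDl; repeat apply: addr_ge0.
all: by repeat (apply: sumr_ge0 => ? _).
Qed.

(* Barrier argument: [perturb (r t) (delta t)] with [delta] growing
   exponentially fast enough to absorb the variation of [Q] strictly satisfies
   the condition up to [t1]. *)
Lemma gap_flow_ge0 t1 a b c d : gram2_nonneg (tensorC (r 0)) ->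
  time_interval T t1 -> normalized (cvec a b) (cvec c d) ->
  0 <= gap (r t1) a b c d.
Proof.
move=> r0 Dt1 nm; have [t10 _] := Dt1.
have DI t : 0 <= t <= t1 -> time_interval T t.
  by move=> /andP[t0 tt1]; exact: time_interval_le Dt1.
have [B B0 rB] := flow_bounded t10 Dt1.
pose N4 : K := \sum_(i < n) \sum_(j < n) \sum_(k < n) \sum_(l < n) 128.
pose C0 := @Qlipschitz K n B * N4.
have N40 : 0 <= N4 by do 4!(apply: sumr_ge0 => ? _).
have C00 : 0 <= C0.
  apply: mulr_ge0 => //; do 2!(apply: sumr_ge0 => ? _).
  by apply: mulr_ge0 => //; rewrite addr_ge0 // mulr_ge0.
rewrite leNgt; apply/negP => gneg.
(* [m] is the size of the barrier at [t1]: small enough that adding 4 m leaves a negative gap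
   nonpositive, and at most 1 for the Lipschitz bound on [Qtensor]. *)
pose m := Num.min 1 (- gap (r t1) a b c d / 4).
have m0 : 0 < m by rewrite lt_min ltr01 divr_gt0 // oppr_gt0.
have m1 : m <= 1 by rewrite ge_min lexx.
have mg : m <= - gap (r t1) a b c d / 4 by rewrite ge_min lexx orbT.
(* Chosen so that 4 (delta / 2) L = (C0 + 1) delta: the barrier contributes 4 delta, half of delta
   is conceded when stepping back in time, [C0] absorbs the change of Q under the perturbation, and
   1 the error of the difference quotient. *)
pose L := (C0 + 1) / 2.
have L0 : 0 < L by rewrite divr_gt0 // ltr_wpDl.
pose delta t := m * expR (L * (t - t1)).
have delta_gt0 t : 0 < delta t by rewrite mulr_gt0 // expR_gt0.
have delta_le1 t : t <= t1 -> delta t <= 1.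
  move=> tt1; rewrite /delta -[leRHS](mulr1 1) ler_pM // ?expR_ge0 ?(ltW m0) //.
  by rewrite -expR0 ler_expR; apply: mulr_ge0_le0; [exact: ltW | rewrite subr_le0].
pose g t := perturb (r (clip t1 t)) (delta t).
have g_in t : 0 <= t <= t1 -> g t = perturb (r t) (delta t).
  by move=> tI; rewrite /g clip_id.
have cdelta : continuous delta.
  apply: continuous_mul; first exact: cst_continuous.
  move=> t; apply: continuous_comp; last exact: continuous_expR.
  apply: continuousM; first exact: cst_continuous.
  by apply: continuousB; [exact: id | exact: cst_continuous].
have cg i j k l : continuous (fun t => g t i j k l).
  apply: continuous_add; first exact: continuous_flow_clip.
  by apply: continuous_mul => //; exact: cst_continuous.
have t1I : 0 <= t1 <= t1 by rewrite t10 lexx.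
have g1 : gap (g t1) a b c d <= 0.
  rewrite g_in // gap_perturb // /delta subrr mulr0 expR0 mulr1.
  by move: mg; clear; lra.
have [tau [tauI [[a' [b' [c' [d' [nm' gtau]]]]] gpos]]] :=
  first_nonpositive_gap cg t1I nm g1.
have Dtau := DI _ tauI; have [tau0 tau1] := andP tauI.
(* At time 0 the gap of [r] is nonnegative and the barrier adds a strictly positive amount. *)
have tau_gt0 : 0 < tau.
  rewrite lt_def tau0 andbT; apply/eqP => tauE; move: gtau.
  have gap0 : 0 <= gap (r 0) a' b' c' d'.
    by apply: gap_gram2_nonneg => //; apply: r_sym; rewrite -tauE.
  have delta0 : 0 < 4 * delta 0 by exact: mulr_gt0.
  by rewrite g_in // gap_perturb // tauE leNgt ltr_wpDl.
have gsym : curvature_symmetries (g tau).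
  by rewrite g_in //; apply: perturb_sym; exact: r_sym.
(* A negative gap at [tau] would persist slightly earlier by continuity, where all gaps are
   positive. *)
have gtau_ge0 x y z w : normalized (cvec x y) (cvec z w) -> 0 <= gap (g tau) x y z w.
  move=> nmx; rewrite leNgt; apply/negP => gx.
  have /cvgrPdist_lt : {for tau, continuous (fun t => gap (g t) x y z w)}.
    by apply: continuous_gap => //; exact: cst_continuous.
  move=> /(_ (- gap (g tau) x y z w)); rewrite oppr_gt0 => /(_ gx).
  move=> /nbhs_ballP[e e0 he].
  pose s := tau - Num.min tau (e / 2).
  have u0 : 0 < Num.min tau (e / 2) by rewrite lt_min tau_gt0 divr_gt0.
  have u1 : Num.min tau (e / 2) <= tau by rewrite ge_min lexx.
  have u2 : Num.min tau (e / 2) <= e / 2 by rewrite ge_min lexx orbT.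
  have := gpos s _ _ _ _ _ _ nmx.
  rewrite subr_ge0 u1 ltrBlDr ltrDl u0 => /(_ isT isT).
  have := he s; rewrite /ball /= /s opprB addrC subrK (gtr0_norm u0).
  rewrite ltr_norml => h hs.
  have /h/andP[h1 _] : Num.min tau (e / 2) < e.
    by apply: le_lt_trans u2 _; rewrite ltr_pdivrMr // ltr_pMr // ltr1n.
  by move: h1; rewrite opprK ltrDl oppr_gt0 => /(lt_trans hs); rewrite ltxx.
have gE : gap (g tau) a' b' c' d' = 0.
  by apply/eqP; rewrite eq_le gtau gtau_ge0.
have Qg_ge0 : 0 <= isoform (Qtensor (g tau)) a' b' c' d'.
  exact: isoform_Qtensor_ge0 gsym (gram2_nonneg_gap gsym gtau_ge0) gE.
have Qr_ge : - (C0 * delta tau) <= isoform (Qtensor (r tau)) a' b' c' d'.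
  have dI : 0 <= delta tau <= 1 by rewrite ltW ?delta_le1.
  have := isoform_le nm' (Qtensor_perturb_le dI (rB _ tauI)).
  have -> : isoform (fun i j k l => Qtensor (perturb (r tau) (delta tau)) i j k l
      - Qtensor (r tau) i j k l) a' b' c' d'
    = isoform (Qtensor (g tau)) a' b' c' d' - isoform (Qtensor (r tau)) a' b' c' d'.
    rewrite g_in // -mulN1r -isoformZ -isoformD; congr (isoform _ _ _ _ _).
    do 4!(apply/funext => ?).
    by rewrite mulN1r.
  rewrite -mulrA -/N4 -/C0 ler_norml mulrC => /andP[_].
  move: Qg_ge0; clear; lra.
have [e e0 he] := has_derivative_withinP
  (@isoform_flow tau a' b' c' d' Dtau) (delta_gt0 tau).
(* The backward step stays in the time interval, within range of the derivative estimate, and keeps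
   L u <= 1/2, so that the barrier is at least halfway up at [s]. *)
pose u := Num.min tau (Num.min (e / 2) ((2 * L)^-1)).
have u0 : 0 < u by rewrite !lt_min tau_gt0 divr_gt0 // invr_gt0 mulr_gt0.
have u1 : u <= tau by rewrite ge_min lexx.
have u2 : u <= e / 2 by rewrite /u !ge_min lexx orbT.
have u3 : u <= (2 * L)^-1 by rewrite /u !ge_min lexx !orbT.
pose s := tau - u.
have sI : 0 <= s <= t1 by rewrite subr_ge0 u1 (le_trans _ tau1) // gerBl ltW.
have s_lt : s < tau by rewrite ltrBlDr ltrDl.
have su : s - tau = - u by rewrite /s; ring.
have := he s (DI _ sI); rewrite (lt_eqF s_lt) su normrN (gtr0_norm u0) => /(_ isT).
have ue : u < e.
  by apply: le_lt_trans u2 _; rewrite ltr_pdivrMr // ltr_pMr // ltr1n.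
move=> /(_ ue); set q := (_ / _); rewrite ltr_norml => /andP[q_gt _].
have qE : isoform (r s) a' b' c' d' - isoform (r tau) a' b' c' d' = - (q * u).
  by rewrite /q; field; rewrite gt_eqF.
have := gpos s _ s_lt a' b' c' d' nm'; case/andP: (sI) => s0 _; move=> /(_ s0).
rewrite g_in // gap_perturb //; move: gE; rewrite g_in // gap_perturb //.
rewrite /gap => gE gs.
have delta_s : delta tau = delta s * expR (L * u).
  rewrite /delta -mulrA -expRD; congr (_ * expR _).
  by rewrite /s; ring.
have delta_s' : delta s = delta tau * expR (- (L * u)).
  by rewrite delta_s -mulrA -expRD subrr expR0 mulr1.
have Lu : L * u <= 1 / 2.
  rewrite mulrC; apply: le_trans (ler_wpM2r (ltW L0) u3) _.
  by rewrite invfM divfK ?gt_eqF // mul1r.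
have half : delta tau / 2 <= delta s.
  rewrite delta_s' ler_pM2l //; apply: le_trans (expR_ge1Dx _).
  by move: Lu; clear; lra.
have grow : delta s * (L * u) <= delta tau - delta s.
  rewrite {1}delta_s -[X in _ - X]mulr1 -mulrBr ler_pM2l //.
  by rewrite lerBrDl expR_ge1Dx.
have k1 : delta tau / 2 * (L * u) <= delta s * (L * u).
  by rewrite ler_pM2r // mulr_gt0.
have k2 : - ((C0 + 1) * delta tau) * u < q * u.
  by rewrite ltr_pM2r //; move: q_gt Qr_ge; clear; lra.
have LE : delta tau / 2 * (L * u) * 4 = (C0 + 1) * delta tau * u.
  by rewrite /L; field.
(* From [s] to [tau] the barrier gains at least (C0 + 1) delta(tau) u while the curvature term loses
   strictly less, so the gap at [s] would be negative. *)
move: gE gs qE grow k1 k2 LE; clear; lra.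
Qed.

Lemma gram2_nonneg_flow t1 : gram2_nonneg (tensorC (r 0)) ->
  time_interval T t1 -> gram2_nonneg (tensorC (r t1)).
Proof.
move=> r0 Dt1; apply: gram2_nonneg_gap; first exact: r_sym.
by move=> a b c d nm; exact: gap_flow_ge0.
Qed.

End Flow.

Theorem proposition10 (K : realType) (n : nat) (hn : (4 <= n)%N)
    (T : \bar K) (R : K -> form4 'rV[K]_n)
    (hR : Q_ode_solution T R) (hR0 : E (R 0)) :
  forall t : K, time_interval T t -> E (R t).
Proof.
move=> t Dt; have [aRt _] := hR t Dt; split=> //.
have [aR0 nic0] := hR0.
apply: nic_of_gram2_nonneg => //.
apply: (@gram2_nonneg_flow K n T (fun s => components (R s))) Dt.
- by move=> s /hR[aRs _]; exact: components_sym.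
(* [Q] evaluated on basis vectors is convertible to [Qtensor] of the components. *)
- by move=> s /hR[_ dR] i j k l; exact: dR.
- exact: gram2_nonneg_of_nic.
Qed.
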